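(* Let $\mathcal{F}$ be a Fréchet space of entire maps $\mathbb{C}\to\mathbb{C}$ that contains all complex polynomial maps and whose topology is finer than the topology of local uniform convergence on $\mathbb{C}$. Let $E$ be a countable dense subset of $\mathbb{C}$ and let $\Lambda$ be a dense subset of $\mathbb{C}$. Then the set of $f\in\mathcal{F}$ such that (1) $f^{-1}(E)=E$, (2) every periodic point of $f$ lies in $E$, (3) the multiplier of $f$ at each of its cycles lies in $\Lambda$, is dense in $\mathcal{F}$.
   Context: For an entire map $f$ and a cycle $\{z, f(z),\dots,f^{\circ(n-1)}(z)\}$ of exact period $n$, the multiplier of $f$ at this cycle is $(f^{\circ n})'(z)$. *)

(* Defs.v *)
From Stdlib Require Import Reals.
From Coquelicot Require Import Coquelicot.
Open Scope R_scope.

Definition has_cderiv (f : C -> C) (z l : C) : Prop :=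
  forall eps : R, 0 < eps -> exists delta : R, 0 < delta /\
    forall h : C, h <> RtoC 0 -> Cmod h < delta ->
      Cmod (Cminus (Cdiv (Cminus (f (Cplus z h)) (f z)) h) l) < eps.

Definition entire (f : C -> C) : Prop := forall z, exists l, has_cderiv f z l.

Definition fsub (f g : C -> C) : C -> C := fun z => Cminus (f z) (g z).
Definition fadd (f g : C -> C) : C -> C := fun z => Cplus (f z) (g z).
Definition fscal (c : C) (f : C -> C) : C -> C := fun z => Cmult c (f z).
Definition fzero : C -> C := fun _ => RtoC 0.

Fixpoint csum (a : nat -> C) (n : nat) : C :=
  match n with
  | O => a O
  | S m => Cplus (csum a m) (a (S m))
  end.
Definition is_poly_map (f : C -> C) : Prop :=
  exists (a : nat -> C) (n : nat), forall z, f z = csum (fun k => Cmult (a k) (Cpow z k)) n.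

(* A Frechet space of entire maps: a complex vector subspace F of C -> C consisting
   of entire maps, whose topology is given by a countable separating family of
   seminorms p n (n : nat), and which is complete for this family. *)
Record FrechetEntire (F : (C -> C) -> Prop) (p : nat -> (C -> C) -> R) : Prop := {
  fr_entire : forall f, F f -> entire f;
  fr_zero : F fzero;
  fr_add : forall f g, F f -> F g -> F (fadd f g);
  fr_scal : forall c f, F f -> F (fscal c f);
  fr_nonneg : forall n f, F f -> 0 <= p n f;
  fr_triangle : forall n f g, F f -> F g -> p n (fadd f g) <= p n f + p n g;
  fr_homog : forall n c f, F f -> p n (fscal c f) = Cmod c * p n f;
  fr_separating : forall f, F f -> (forall n, p n f = 0) -> f = fzero;
  fr_complete : forall u : nat -> C -> C, (forall k, F (u k)) ->
    (forall n eps, 0 < eps -> exists K, forall k l, (K <= k)%nat -> (K <= l)%nat ->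
        p n (fsub (u k) (u l)) < eps) ->
    exists f, F f /\ forall n eps, 0 < eps -> exists K, forall k, (K <= k)%nat ->
        p n (fsub (u k) f) < eps
}.

(* The topology of F is finer than that of local uniform convergence on C:
   the (linear) inclusion F -> C(C) is continuous (at 0). *)
Definition finer_than_local_uniform (F : (C -> C) -> Prop) (p : nat -> (C -> C) -> R) : Prop :=
  forall r eps : R, 0 < r -> 0 < eps -> exists (N : nat) (delta : R), 0 < delta /\
    forall f, F f -> (forall n, (n <= N)%nat -> p n f < delta) ->
      forall z, Cmod z <= r -> Cmod (f z) < eps.

Definition countable_set (E : C -> Prop) : Prop :=
  exists e : nat -> C, forall z, E z -> exists k, e k = z.
Definition dense_set (E : C -> Prop) : Prop :=
  forall z eps, 0 < eps -> exists w, E w /\ Cmod (Cminus w z) < eps.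

Definition iterate (f : C -> C) (n : nat) : C -> C := fun z => Nat.iter n f z.

Definition periodic_point (f : C -> C) (z : C) : Prop :=
  exists n, (1 <= n)%nat /\ iterate f n z = z.

Definition exact_period (f : C -> C) (z : C) (n : nat) : Prop :=
  (1 <= n)%nat /\ iterate f n z = z /\
  forall m, (1 <= m)%nat -> (m < n)%nat -> iterate f m z <> z.

Definition multiplier_at (f : C -> C) (z : C) (n : nat) (lam : C) : Prop :=
  exact_period f z n /\ has_cderiv (iterate f n) z lam.

Definition good_map (E Lam : C -> Prop) (f : C -> C) : Prop :=
  (forall z, E (f z) <-> E z) /\
  (forall z, periodic_point f z -> E z) /\
  (forall z n lam, multiplier_at f z n lam -> Lam lam).

(* Main.v *)
(** A small perturbation [g] of [f] is built as a limit [f + q_0 + q_1 + ...] with polynomials [q_k], the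
    conditions on [g] being met one after the other. At each stage there is a finite set [A] of points of [E]
    with images in [E], and all later [q_k] vanish to second order on [A]; so the values and derivatives on [A],
    and the cycles inside [A] with their multipliers, are final.

    The condition that all zeros of [T g] in a disc lie in [E], where [T g] is [g - e] or [g^n - id], is met as
    follows. A zero not controlled by [A] (its orbit, in the case of cycles) is moved into [E] by Hermite
    interpolation, which also prescribes a nonzero derivative, respectively a multiplier in [Lam] off the unit
    circle, so that the new zero of [T g] is simple. The number of zeros in a disc is bounded near a given map,
    so after finitely many moves all zeros in the disc are controlled; being simple, they are then the only
    zeros there for every later small perturbation that agrees to second order on [A].

    The function theory needed is obtained from Goursat's theorem on rectangles: in logarithmic coordinates it
    gives the mean value property at [z0] for functions continuous at [z0] and holomorphic around it. Hence the
    maximum principle holds for continuous functions that are holomorphic off a finite set; applied to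
    quotients [f / prod (z - w_i)] and [(f z - f w) / (z - w)] it bounds the number of zeros and the
    derivatives of an entire function by its supremum on a larger disc. *)

Require Import Defs.
From Stdlib Require Import Reals Lra Lia Compare_dec ClassicalEpsilon FunctionalExtensionality List Cantor.
From Coquelicot Require Import Coquelicot.
Open Scope R_scope.

(** * Complex differentiability *)

(** Hence a condition is made stable by freezing finite data, and the limit is built by hand.
    Freezing creates the main difficulty: a point added to [A] for the sake of a value or a preimage
    might close a cycle inside [A] whose multiplier is not under control. Such cycles are avoided by
    the choice of the new point or of its image. An intended cycle is frozen as a whole while at
    least one of its points is still free: the derivative there steers the multiplier into [Lam],
    which requires all other derivatives along the cycle to be nonzero. Zeros are only ever counted
    from above; the existence of a zero near a given one comes from interpolation, so the maximum
    principle can replace the argument principle. *)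

Lemma Cmod_minus_sym (z w : C) : Cmod (z - w) = Cmod (w - z).
Proof. replace (z - w)%C with (- (w - z))%C by ring. apply Cmod_opp. Qed.

Lemma Cmod_sub_triangle (x y z : C) : Cmod (x - z) <= Cmod (x - y) + Cmod (y - z).
Proof. replace (x - z)%C with ((x - y) + (y - z))%C by ring. apply Cmod_triangle. Qed.

Lemma Cmod_le_sub (x y : C) : Cmod x <= Cmod y + Cmod (x - y).
Proof. replace x with (y + (x - y))%C at 1 by ring. apply Cmod_triangle. Qed.

Lemma Cmod_minus_le (x y : C) : Cmod (x - y) <= Cmod x + Cmod y.
Proof. rewrite <- (Cmod_opp y). apply Cmod_triangle. Qed.

Lemma Cminus_eq_0 (x y : C) : (x - y)%C = 0%C -> x = y.
Proof. intros H. replace x with ((x - y) + y)%C by ring. rewrite H. ring. Qed.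

Lemma Cminus_neq_0 (x y : C) : x <> y -> (x - y)%C <> 0%C.
Proof. intros H H0. apply H, Cminus_eq_0, H0. Qed.

Lemma Cmod_sub_pos (x y : C) : x <> y -> 0 < Cmod (x - y).
Proof. intros H. apply Cmod_gt_0, Cminus_neq_0, H. Qed.

Lemma Cmod_pos (x : C) : x <> 0%C -> 0 < Cmod x.
Proof. apply Cmod_gt_0. Qed.

Lemma Cmod_pos_neq (x : C) : 0 < Cmod x -> x <> 0%C.
Proof. apply Cmod_gt_0. Qed.

Lemma Cmod_sub_diag (x : C) : Cmod (x - x) = 0.
Proof. replace (x - x)%C with (RtoC 0) by ring. apply Cmod_0. Qed.

Definition ccont (f : C -> C) (z : C) : Prop :=
  forall eps, 0 < eps -> exists delta, 0 < delta /\
    forall y, Cmod (y - z) < delta -> Cmod (f y - f z) < eps.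

Lemma ccont_const c z : ccont (fun _ => c) z.
Proof.
  intros eps He. exists 1. split; [lra|]. intros y _. rewrite Cmod_sub_diag. exact He.
Qed.

Lemma ccont_id z : ccont (fun y => y) z.
Proof. intros eps He. exists eps. split; auto. Qed.

Lemma ccont_ext (f g : C -> C) z : (forall y, f y = g y) -> ccont f z -> ccont g z.
Proof.
  intros H Hf eps He. destruct (Hf eps He) as [d [Hd H1]]. exists d. split; auto.
  intros y Hy. rewrite <- !H. auto.
Qed.

Lemma ccont_ext_loc (f g : C -> C) z r : 0 < r ->
  (forall y, Cmod (y - z) < r -> f y = g y) -> ccont f z -> ccont g z.
Proof.
  intros Hr H Hf eps He. destruct (Hf eps He) as [d [Hd H1]]. exists (Rmin d r).
  split. { apply Rmin_pos; auto. }
  intros y Hy.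
  pose proof (Rmin_l d r). pose proof (Rmin_r d r).
  rewrite <- !H. { apply H1. lra. } { rewrite Cmod_sub_diag. lra. } lra.
Qed.

Lemma ccont_plus f g z : ccont f z -> ccont g z -> ccont (fun y => f y + g y)%C z.
Proof.
  intros Hf Hg eps He.
  destruct (Hf (eps/2)) as [d [Hd H1]]; [lra|].
  destruct (Hg (eps/2)) as [d' [Hd' H1']]; [lra|].
  exists (Rmin d d'). split. { apply Rmin_pos; auto. }
  intros y Hy. pose proof (Rmin_l d d'). pose proof (Rmin_r d d').
  specialize (H1 y ltac:(lra)). specialize (H1' y ltac:(lra)).
  replace (f y + g y - (f z + g z))%C with ((f y - f z) + (g y - g z))%C by ring.
  eapply Rle_lt_trans; [apply Cmod_triangle|]. lra.
Qed.

Lemma ccont_mult f g z : ccont f z -> ccont g z -> ccont (fun y => f y * g y)%C z.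
Proof.
  intros Hf Hg eps He.
  pose proof (Cmod_ge_0 (f z)) as F0. pose proof (Cmod_ge_0 (g z)) as G0.
  set (e1 := Rmin 1 (eps / (2 * (Cmod (g z) + 1)))).
  set (e2 := eps / (2 * (Cmod (f z) + 1))).
  assert (He1 : 0 < e1). { apply Rmin_pos; [lra|]. apply Rdiv_lt_0_compat; lra. }
  assert (He2 : 0 < e2). { apply Rdiv_lt_0_compat; lra. }
  destruct (Hf e1 He1) as [d [Hd H1]]. destruct (Hg e2 He2) as [d' [Hd' H1']].
  exists (Rmin d d'). split. { apply Rmin_pos; auto. }
  intros y Hy. pose proof (Rmin_l d d'). pose proof (Rmin_r d d').
  specialize (H1 y ltac:(lra)). specialize (H1' y ltac:(lra)).
  replace (f y * g y - (f z * g z))%C with ((f y - f z) * g z + f y * (g y - g z))%C by ring.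
  eapply Rle_lt_trans; [apply Cmod_triangle|]. rewrite !Cmod_mult.
  assert (Hf1 : Cmod (f y) <= Cmod (f z) + 1).
  { eapply Rle_trans; [apply (Cmod_le_sub _ (f z))|]. assert (e1 <= 1) by apply Rmin_l. lra. }
  assert (A : e1 * (2 * (Cmod (g z) + 1)) <= eps).
  { apply Rle_trans with (eps / (2 * (Cmod (g z) + 1)) * (2 * (Cmod (g z) + 1))).
    - apply Rmult_le_compat_r; [lra|apply Rmin_r].
    - right. field. lra. }
  assert (B : e2 * (2 * (Cmod (f z) + 1)) = eps). { unfold e2. field. lra. }
  pose proof (Cmod_ge_0 (f y - f z)). pose proof (Cmod_ge_0 (g y - g z)).
  pose proof (Cmod_ge_0 (f y)).
  assert (Cmod (f y) * Cmod (g y - g z) <= (Cmod (f z) + 1) * Cmod (g y - g z))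
    by (apply Rmult_le_compat_r; lra).
  assert ((Cmod (f z) + 1) * Cmod (g y - g z) < (Cmod (f z) + 1) * e2)
    by (apply Rmult_lt_compat_l; lra).
  assert (Cmod (f y - f z) * Cmod (g z) <= e1 * Cmod (g z))
    by (apply Rmult_le_compat_r; lra).
  nra.
Qed.

Lemma ccont_comp f g z : ccont f z -> ccont g (f z) -> ccont (fun y => g (f y)) z.
Proof.
  intros Hf Hg eps He. destruct (Hg eps He) as [d [Hd H]].
  destruct (Hf d Hd) as [d' [Hd' H']]. exists d'. split; auto.
Qed.

Lemma ccont_inv (z : C) : z <> 0%C -> ccont Cinv z.
Proof.
  intros Hz eps He. pose proof (Cmod_pos _ Hz) as Hm.
  set (m := Cmod z) in *.
  exists (Rmin (m / 2) (eps * (m * m) / 2)).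
  split. { apply Rmin_pos; [lra|]. assert (0 < eps * (m * m)) by (repeat apply Rmult_lt_0_compat; auto). lra. }
  intros y Hy. pose proof (Rmin_l (m/2) (eps * (m * m) / 2)). pose proof (Rmin_r (m/2) (eps * (m * m) / 2)).
  assert (Hy2 : m / 2 < Cmod y).
  { pose proof (Cmod_le_sub z y). rewrite Cmod_minus_sym in H1. fold m in H1. lra. }
  assert (Hy0 : y <> 0%C). { apply Cmod_pos_neq. lra. }
  replace (/ y - / z)%C with ((z - y) / (y * z))%C by (field; split; assumption).
  rewrite Cmod_div by (apply Cmult_neq_0; assumption). rewrite Cmod_mult. fold m.
  rewrite (Cmod_minus_sym z y).
  apply Rmult_lt_reg_r with (Cmod y * m). { apply Rmult_lt_0_compat; lra. }
  unfold Rdiv. rewrite Rmult_assoc, Rinv_l, Rmult_1_r by (apply Rgt_not_eq, Rmult_lt_0_compat; lra).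
  assert (eps * (m * m / 2) < eps * (Cmod y * m)).
  { apply Rmult_lt_compat_l; auto. nra. }
  lra.
Qed.

(* Caratheodory's form of differentiability, which reduces the differentiation rules to continuity. *)
Lemma cderiv_slope f z l : has_cderiv f z l ->
  exists phi, ccont phi z /\ phi z = l /\ forall y, f y = (f z + phi y * (y - z))%C.
Proof.
  intros H.
  exists (fun y => if excluded_middle_informative (y = z) then l else ((f y - f z) / (y - z))%C).
  split; [|split].
  - intros eps He. destruct (H eps He) as [d [Hd H1]]. exists d. split; auto.
    intros y Hy. destruct (excluded_middle_informative (z = z)) as [_|n]; [|now destruct n].
    destruct (excluded_middle_informative (y = z)) as [_|n].
    + rewrite Cmod_sub_diag. exact He.
    + specialize (H1 (y - z)%C (Cminus_neq_0 _ _ n) Hy).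
      replace (z + (y - z))%C with y in H1 by ring. exact H1.
  - destruct (excluded_middle_informative (z = z)) as [_|n]; [auto|now destruct n].
  - intros y. destruct (excluded_middle_informative (y = z)) as [->|n].
    + ring.
    + field. now apply Cminus_neq_0.
Qed.

Lemma slope_cderiv f phi z : ccont phi z -> (forall y, f y = (f z + phi y * (y - z))%C) ->
  has_cderiv f z (phi z).
Proof.
  intros H E eps He. destruct (H eps He) as [d [Hd H1]]. exists d. split; auto.
  intros h Hh Hm. specialize (H1 (z + h)%C).
  replace (z + h - z)%C with h in H1 by ring. specialize (H1 Hm).
  rewrite (E (z + h)%C).
  replace ((f z + phi (z + h) * (z + h - z) - f z) / h)%C with (phi (z + h))%C by (field; exact Hh).
  exact H1.
Qed.

Lemma slope_cderiv_eq f phi z l : ccont phi z -> (forall y, f y = (f z + phi y * (y - z))%C) ->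
  phi z = l -> has_cderiv f z l.
Proof. intros H1 H2 <-. now apply slope_cderiv. Qed.

Lemma cderiv_cont f z l : has_cderiv f z l -> ccont f z.
Proof.
  intros H. destruct (cderiv_slope _ _ _ H) as [phi [H1 [_ H2]]].
  apply ccont_ext with (fun y => f z + phi y * (y + - z))%C.
  { intros y. rewrite (H2 y). reflexivity. }
  apply ccont_plus; [apply ccont_const|]. apply ccont_mult; auto.
  apply ccont_plus; [apply ccont_id|apply ccont_const].
Qed.

Lemma entire_cont f : entire f -> forall z, ccont f z.
Proof. intros H z. destruct (H z) as [l Hl]. now apply cderiv_cont with l. Qed.

Lemma cderiv_unique f z l l' : has_cderiv f z l -> has_cderiv f z l' -> l = l'.
Proof.
  intros H H'. destruct (classic (l = l')) as [|n]; auto. exfalso.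
  apply Cmod_sub_pos in n.
  destruct (H (Cmod (l - l') / 2)) as [d [Hd H1]]; [lra|].
  destruct (H' (Cmod (l - l') / 2)) as [d' [Hd' H1']]; [lra|].
  pose proof (Rmin_l d d'). pose proof (Rmin_r d d').
  assert (0 < Rmin d d') by (apply Rmin_pos; auto).
  set (h := RtoC (Rmin d d' / 2)).
  assert (Hh : Cmod h = Rmin d d' / 2). { unfold h. rewrite Cmod_R. apply Rabs_pos_eq. lra. }
  assert (h0 : h <> 0%C). { apply Cmod_pos_neq. lra. }
  specialize (H1 h h0 ltac:(lra)). specialize (H1' h h0 ltac:(lra)).
  rewrite Cmod_minus_sym in H1.
  pose proof (Cmod_sub_triangle l ((f (z + h) - f z) / h)%C l'). lra.
Qed.

Lemma cderiv_ext f g z l : (forall y, f y = g y) -> has_cderiv f z l -> has_cderiv g z l.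
Proof.
  intros H Hf eps He. destruct (Hf eps He) as [d [Hd H1]]. exists d. split; auto.
  intros h h0 Hh. rewrite <- !H. auto.
Qed.

Lemma cderiv_ext_loc f g z l r : 0 < r ->
  (forall y, Cmod (y - z) < r -> f y = g y) -> has_cderiv f z l -> has_cderiv g z l.
Proof.
  intros Hr H Hf eps He. destruct (Hf eps He) as [d [Hd H1]]. exists (Rmin d r).
  split. { apply Rmin_pos; auto. }
  intros h h0 Hh. pose proof (Rmin_l d r). pose proof (Rmin_r d r).
  rewrite <- !H. { apply H1; auto. lra. }
  { rewrite Cmod_sub_diag. lra. } { replace (z + h - z)%C with h by ring. lra. }
Qed.

Lemma cderiv_eq f z l l' : has_cderiv f z l -> l = l' -> has_cderiv f z l'.
Proof. now intros H <-. Qed.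

Lemma cderiv_const c z : has_cderiv (fun _ => c) z 0%C.
Proof.
  apply slope_cderiv_eq with (fun _ => 0%C); [apply ccont_const| |auto]. intros; ring.
Qed.

Lemma cderiv_id z : has_cderiv (fun y => y) z 1%C.
Proof.
  apply slope_cderiv_eq with (fun _ => 1%C); [apply ccont_const| |auto]. intros; ring.
Qed.

Lemma cderiv_plus f g z a b : has_cderiv f z a -> has_cderiv g z b ->
  has_cderiv (fun y => f y + g y)%C z (a + b)%C.
Proof.
  intros Hf Hg. destruct (cderiv_slope _ _ _ Hf) as [p [P1 [P2 P3]]].
  destruct (cderiv_slope _ _ _ Hg) as [q [Q1 [Q2 Q3]]].
  apply slope_cderiv_eq with (fun y => p y + q y)%C.
  - now apply ccont_plus.
  - intros y. rewrite (P3 y), (Q3 y). ring.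
  - now rewrite P2, Q2.
Qed.

Lemma cderiv_mult f g z a b : has_cderiv f z a -> has_cderiv g z b ->
  has_cderiv (fun y => f y * g y)%C z (a * g z + f z * b)%C.
Proof.
  intros Hf Hg. pose proof (cderiv_cont _ _ _ Hg) as Cg.
  destruct (cderiv_slope _ _ _ Hf) as [p [P1 [P2 P3]]].
  destruct (cderiv_slope _ _ _ Hg) as [q [Q1 [Q2 Q3]]].
  apply slope_cderiv_eq with (fun y => p y * g y + f z * q y)%C.
  - apply ccont_plus; apply ccont_mult; auto using ccont_const.
  - intros y. rewrite (P3 y), (Q3 y). ring.
  - now rewrite P2, Q2.
Qed.

Lemma cderiv_scal c f z a : has_cderiv f z a -> has_cderiv (fun y => c * f y)%C z (c * a)%C.
Proof.
  intros H. replace (c * a)%C with (0 * f z + c * a)%C by ring.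
  exact (cderiv_mult (fun _ => c) f z _ _ (cderiv_const c z) H).
Qed.

Lemma cderiv_minus f g z a b : has_cderiv f z a -> has_cderiv g z b ->
  has_cderiv (fun y => f y - g y)%C z (a - b)%C.
Proof.
  intros Hf Hg. replace (a - b)%C with (a + (-(1)) * b)%C by ring.
  apply cderiv_ext with (fun y => f y + (-(1)) * g y)%C. { intros; ring. }
  apply cderiv_plus; auto. now apply cderiv_scal.
Qed.

Lemma cderiv_comp f g z a b : has_cderiv f z a -> has_cderiv g (f z) b ->
  has_cderiv (fun y => g (f y)) z (b * a)%C.
Proof.
  intros Hf Hg. pose proof (cderiv_cont _ _ _ Hf) as Cf.
  destruct (cderiv_slope _ _ _ Hf) as [p [P1 [P2 P3]]].
  destruct (cderiv_slope _ _ _ Hg) as [q [Q1 [Q2 Q3]]].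
  apply slope_cderiv_eq with (fun y : C => q (f y) * p y)%C.
  - apply ccont_mult; auto. apply ccont_comp; auto.
  - intros y. rewrite (Q3 (f y)). rewrite (P3 y) at 2. ring.
  - now rewrite P2, Q2.
Qed.

Lemma cderiv_inv (z : C) : z <> 0%C -> exists l, has_cderiv Cinv z l.
Proof.
  intros Hz. exists (- / z * / z)%C.
  (* [slope_cderiv_eq] wants the slope identity at every [y], but the slope [- / y * / z] makes
     sense only off 0. So [Cinv] is replaced by a function that equals it near [z] and has slope 0
     at [y = 0]. *)
  apply cderiv_ext_loc with (fun y : C => / z + (if excluded_middle_informative (y = 0%C) then 0 else (- / y * / z)) * (y - z))%C (Cmod z).
  - now apply Cmod_gt_0.
  - intros y Hy. destruct (excluded_middle_informative (y = 0%C)) as [->|n].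
    + exfalso. replace (0 - z)%C with (- z)%C in Hy by ring. rewrite Cmod_opp in Hy. lra.
    + field. split; auto.
  - eapply slope_cderiv_eq.
    2: { intros y. destruct (excluded_middle_informative (z = 0%C)) as [e|_]; [now destruct Hz|].
      instantiate (1 := fun y : C => if excluded_middle_informative (y = 0%C) then 0%C else (- / y * / z)%C).
      simpl. ring. }
    + apply ccont_ext_loc with (fun y : C => - (1) * / y * / z)%C (Cmod z).
      * now apply Cmod_gt_0.
      * intros y Hy. destruct (excluded_middle_informative (y = 0%C)) as [->|n].
        -- exfalso. replace (0 - z)%C with (- z)%C in Hy by ring. rewrite Cmod_opp in Hy. lra.
        -- ring.
      * apply ccont_mult; [apply ccont_mult|]; auto using ccont_const, ccont_inv.
    + simpl. destruct (excluded_middle_informative (z = 0%C)) as [e|_]; [now destruct Hz|]. reflexivity.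
Qed.

Lemma entire_plus f g : entire f -> entire g -> entire (fun z => f z + g z)%C.
Proof.
  intros Hf Hg z. destruct (Hf z) as [a Ha], (Hg z) as [b Hb]. eexists. now apply cderiv_plus; eauto.
Qed.

Lemma entire_minus f g : entire f -> entire g -> entire (fun z => f z - g z)%C.
Proof.
  intros Hf Hg z. destruct (Hf z) as [a Ha], (Hg z) as [b Hb]. eexists. now apply cderiv_minus; eauto.
Qed.

Lemma entire_mult f g : entire f -> entire g -> entire (fun z => f z * g z)%C.
Proof.
  intros Hf Hg z. destruct (Hf z) as [a Ha], (Hg z) as [b Hb]. eexists. now apply cderiv_mult; eauto.
Qed.

Lemma entire_comp f g : entire f -> entire g -> entire (fun z => g (f z)).
Proof.
  intros Hf Hg z. destruct (Hf z) as [a Ha], (Hg (f z)) as [b Hb]. eexists. now apply cderiv_comp; eauto.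
Qed.

Lemma entire_const c : entire (fun _ => c).
Proof. intros z. eexists. apply cderiv_const. Qed.

Lemma entire_id : entire (fun z => z).
Proof. intros z. eexists. apply cderiv_id. Qed.
Lemma cderiv_of_eps (f : C -> C) (z l : C) :
  (forall eps, 0 < eps -> exists delta, 0 < delta /\ forall h, Cmod h < delta ->
     Cmod (f (z + h) - f z - l * h)%C <= eps * Cmod h) -> has_cderiv f z l.
Proof.
  intros H eps He. destruct (H (eps / 2)) as [d [Hd H1]]; [lra|].
  exists d. split; auto. intros h h0 Hh. specialize (H1 h Hh).
  pose proof (Cmod_pos _ h0).
  replace ((f (z + h) - f z) / h - l)%C with ((f (z + h) - f z - l * h) / h)%C by (field; exact h0).
  rewrite Cmod_div by exact h0. apply Rle_lt_trans with (eps / 2); [|lra].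
  apply Rmult_le_reg_r with (Cmod h); auto.
  unfold Rdiv at 1. rewrite Rmult_assoc, Rinv_l, Rmult_1_r by lra. exact H1.
Qed.

Lemma eps_of_cderiv (f : C -> C) (z l : C) : has_cderiv f z l ->
  forall eps, 0 < eps -> exists delta, 0 < delta /\ forall y, Cmod (y - z) < delta ->
     Cmod (f y - f z - l * (y - z))%C <= eps * Cmod (y - z).
Proof.
  intros H eps He. destruct (cderiv_slope _ _ _ H) as [p [P1 [P2 P3]]].
  destruct (P1 eps He) as [d [Hd H1]]. exists d. split; auto.
  intros y Hy. rewrite (P3 y), <- P2.
  replace (f z + p y * (y - z) - f z - p z * (y - z))%C with ((p y - p z) * (y - z))%C by ring.
  rewrite Cmod_mult. apply Rmult_le_compat_r; [apply Cmod_ge_0|]. left; auto.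
Qed.

Lemma Cmod_le_Rabs (x y : R) : Cmod (x, y) <= Rabs x + Rabs y.
Proof.
  replace (x, y) with (RtoC x + Ci * RtoC y)%C.
  - eapply Rle_trans; [apply Cmod_triangle|]. rewrite Cmod_mult, Cmod_Ci, !Cmod_R. lra.
  - unfold Cplus, Cmult, RtoC, Ci; simpl. f_equal; ring.
Qed.

Lemma Rabs_fst_le (z : C) : Rabs (fst z) <= Cmod z.
Proof. eapply Rle_trans; [|apply Rmax_Cmod]. apply Rmax_l. Qed.

Lemma Rabs_snd_le (z : C) : Rabs (snd z) <= Cmod z.
Proof. eapply Rle_trans; [|apply Rmax_Cmod]. apply Rmax_r. Qed.

(** * The complex exponential *)

Definition cexp (z : C) : C := (exp (fst z) * cos (snd z), exp (fst z) * sin (snd z)).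

Lemma cexp_plus (z w : C) : cexp (z + w) = (cexp z * cexp w)%C.
Proof.
  destruct z as [a b], w as [c d]. unfold cexp, Cplus, Cmult; simpl.
  rewrite exp_plus, cos_plus, sin_plus. f_equal; ring.
Qed.

Lemma Cmod_cexp (z : C) : Cmod (cexp z) = exp (fst z).
Proof.
  destruct z as [a b]. unfold cexp, Cmod; simpl.
  replace (exp a * cos b * (exp a * cos b * 1) + exp a * sin b * (exp a * sin b * 1))
    with ((exp a * exp a) * (Rsqr (sin b) + Rsqr (cos b))) by (unfold Rsqr; ring).
  rewrite sin2_cos2, Rmult_1_r. apply sqrt_square. left. apply exp_pos.
Qed.

Lemma derivable_pt_lim_eps f x l : derivable_pt_lim f x l ->
  forall eps, 0 < eps -> exists delta, 0 < delta /\ forall h, Rabs h < delta ->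
    Rabs (f (x + h) - f x - l * h) <= eps * Rabs h.
Proof.
  intros H eps He. destruct (H eps He) as [d H1]. exists d. split; [apply cond_pos|].
  intros h Hh. destruct (Req_dec h 0) as [->|n].
  - rewrite Rplus_0_r. replace (f x - f x - l * 0) with 0 by ring. rewrite Rabs_R0. lra.
  - specialize (H1 h n Hh).
    replace (f (x + h) - f x - l * h) with (((f (x + h) - f x) / h - l) * h) by (field; auto).
    rewrite Rabs_mult. apply Rmult_le_compat_r; [apply Rabs_pos|lra].
Qed.

Lemma cderiv_cexp_0 : has_cderiv cexp 0%C 1%C.
Proof.
  apply cderiv_of_eps. intros eps He.
  (* The four error terms below are at most 1, 3, 3 and 2 times [e * Cmod (x, y)], which makes 9 in
     all. *)
  set (e := Rmin 1 (eps / 9)).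
  assert (He0 : 0 < e) by (apply Rmin_pos; lra).
  assert (He1 : e <= 1) by apply Rmin_l. assert (He9 : e <= eps / 9) by apply Rmin_r.
  destruct (derivable_pt_lim_eps _ _ _ (derivable_pt_lim_exp 0) e He0) as [d1 [D1 H1]].
  destruct (derivable_pt_lim_eps _ _ _ (derivable_pt_lim_sin 0) e He0) as [d2 [D2 H2]].
  destruct (derivable_pt_lim_eps _ _ _ (derivable_pt_lim_cos 0) e He0) as [d3 [D3 H3]].
  exists (Rmin e (Rmin d1 (Rmin d2 d3))).
  split. { repeat apply Rmin_pos; lra. }
  intros [x y] Hh. rewrite Cplus_0_l.
  pose proof (Rabs_fst_le (x, y)) as Hx. pose proof (Rabs_snd_le (x, y)) as Hy. simpl in Hx, Hy.
  assert (Hm : Cmod (x, y) < e /\ Cmod (x, y) < d1 /\ Cmod (x, y) < d2 /\ Cmod (x, y) < d3).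
  { repeat split; eapply Rlt_le_trans; try exact Hh.
    - apply Rmin_l.
    - eapply Rle_trans; [apply Rmin_r|]. apply Rmin_l.
    - eapply Rle_trans; [apply Rmin_r|]. eapply Rle_trans; [apply Rmin_r|]. apply Rmin_l.
    - eapply Rle_trans; [apply Rmin_r|]. eapply Rle_trans; [apply Rmin_r|]. apply Rmin_r. }
  specialize (H1 x ltac:(lra)). specialize (H2 y ltac:(lra)). specialize (H3 y ltac:(lra)).
  rewrite Rplus_0_l in H1, H2, H3. rewrite exp_0 in H1. rewrite sin_0, cos_0 in H2. rewrite cos_0, sin_0 in H3.
  unfold cexp; simpl. rewrite exp_0, cos_0, sin_0.
  (* The errors of the linear approximations to exp, cos and sin are separated; what remains,
     [(exp x - 1) * y], is of second order. *)
  match goal with |- Cmod ?c <= _ => replace c with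
    ((exp x - 1 - 1 * x) + exp x * (cos y - 1 - - 0 * y), exp x * (sin y - 0 - 1 * y) + (exp x - 1) * y)%R end.
  2: { unfold Cminus, Cplus, Copp, Cmult, RtoC; simpl. f_equal; ring. }
  eapply Rle_trans; [apply Cmod_le_Rabs|].
  pose proof (Rabs_triang (exp x - 1 - 1 * x) (exp x * (cos y - 1 - - 0 * y))) as T1.
  pose proof (Rabs_triang (exp x * (sin y - 0 - 1 * y)) ((exp x - 1) * y)) as T2.
  rewrite !Rabs_mult in T1. rewrite (Rabs_mult (exp x)), (Rabs_mult (exp x - 1)) in T2.
  pose proof (Rabs_pos x). pose proof (Rabs_pos y).
  assert (X1 : Rabs (exp x - 1) <= 2 * Rabs x).
  { replace (exp x - 1) with ((exp x - 1 - 1 * x) + x) by ring.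
    eapply Rle_trans; [apply Rabs_triang|]. nra. }
  assert (X2 : Rabs (exp x) <= 3).
  { replace (exp x) with ((exp x - 1) + 1) by ring.
    eapply Rle_trans; [apply Rabs_triang|]. rewrite Rabs_R1. nra. }
  pose proof (Rabs_pos (exp x)). pose proof (Rabs_pos (exp x - 1)).
  pose proof (Rabs_pos (cos y - 1 - - 0 * y)). pose proof (Rabs_pos (sin y - 0 - 1 * y)).
  set (m := Cmod (x, y)) in *.
  assert (Rabs (exp x) * Rabs (cos y - 1 - - 0 * y) <= 3 * (e * Rabs y)) by (apply Rmult_le_compat; auto).
  assert (Rabs (exp x) * Rabs (sin y - 0 - 1 * y) <= 3 * (e * Rabs y)) by (apply Rmult_le_compat; auto).
  assert (Rabs (exp x - 1) * Rabs y <= 2 * e * Rabs y) by (apply Rmult_le_compat_r; lra).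
  assert (e * Rabs x <= e * m) by (apply Rmult_le_compat_l; lra).
  assert (e * Rabs y <= e * m) by (apply Rmult_le_compat_l; lra).
  assert (e * m <= eps / 9 * m) by (apply Rmult_le_compat_r; lra).
  lra.
Qed.

Lemma cderiv_cexp z : has_cderiv cexp z (cexp z).
Proof.
  apply cderiv_ext with (fun y => cexp z * cexp (y - z))%C.
  { intros y. rewrite <- cexp_plus. f_equal. ring. }
  apply cderiv_eq with (cexp z * (1 * (1 - 0)))%C; [|ring].
  apply cderiv_scal.
  apply cderiv_comp with (f := fun y => (y - z)%C).
  - apply cderiv_minus; [apply cderiv_id|apply cderiv_const].
  - replace (z - z)%C with (RtoC 0) by ring. apply cderiv_cexp_0.
Qed.

(** * Goursat's theorem on rectangles *)

Lemma nested_intervals (a b : nat -> R) :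
  (forall n, a n <= a (S n)) -> (forall n, b (S n) <= b n) -> (forall n, a n <= b n) ->
  exists p, forall n, a n <= p <= b n.
Proof.
  intros Ha Hb Hab.
  assert (A : forall n k, a n <= a (k + n)%nat).
  { intros n k. induction k; simpl; [lra|]. eapply Rle_trans; eauto. }
  assert (B : forall n k, b (k + n)%nat <= b n).
  { intros n k. induction k; simpl; [lra|]. eapply Rle_trans; eauto. }
  assert (AB : forall m n, a m <= b n).
  { intros m n. apply Rle_trans with (a (n + m)%nat); [apply A|].
    apply Rle_trans with (b (n + m)%nat); auto. rewrite Nat.add_comm. apply B. }
  destruct (completeness (fun x => exists n, x = a n)) as [p [P1 P2]].
  - exists (b O). intros x [n ->]. apply AB.
  - exists (a O), O. auto.
  - exists p. intros n. split.
    + apply P1. now exists n.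
    + apply P2. intros x [m ->]. apply AB.
Qed.

(* [P x y t] is a property of the rectangle [x, x + t w] x [y, y + t h]. *)
Lemma quartering_induction (P : R -> R -> R -> Prop) (x0 y0 w h : R) :
  0 < w -> 0 < h ->
  (forall x y t, 0 < t -> x0 <= x -> x + t * w <= x0 + w ->
     P x y (t / 2) -> P (x + t / 2 * w) y (t / 2) -> P x (y + t / 2 * h) (t / 2) ->
     P (x + t / 2 * w) (y + t / 2 * h) (t / 2) -> P x y t) ->
  (forall p q, x0 <= p <= x0 + w -> exists delta, 0 < delta /\ forall x y t,
     0 < t < delta -> x0 <= x -> x + t * w <= x0 + w ->
     x <= p <= x + t * w -> y <= q <= y + t * h -> P x y t) ->
  P x0 y0 1.
Proof.
  intros Hw Hh Hsplit Hloc.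
  destruct (classic (P x0 y0 1)) as [|nP]; auto. exfalso.
  (* If [P] fails on a rectangle, it fails on a quarter of it; the failing quarters of scale
     [/ 2 ^ n] shrink to a point [(p, q)], near which [Hloc] makes [P] hold. The horizontal position
     is tracked because [Hloc] restricts [p]. *)
  set (good := fun (s : R * R) (t : R) => ~ P (fst s) (snd s) t /\ x0 <= fst s /\ fst s + t * w <= x0 + w).
  set (next := fun (s : R * R) (t : R) (s' : R * R) =>
    good s' (t / 2) /\ fst s <= fst s' <= fst s + t / 2 * w /\ snd s <= snd s' <= snd s + t / 2 * h).
  assert (Hnext : forall s t, 0 < t -> good s t -> exists s', next s t s').
  { intros [x y] t Ht [G1 [G2 G3]]; simpl in *.
    assert (0 < t * w) by (apply Rmult_lt_0_compat; auto).
    assert (0 < t * h) by (apply Rmult_lt_0_compat; auto).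
    apply NNPP. intros N. apply G1. apply Hsplit; auto; apply NNPP; intros Q; apply N.
    - exists (x, y). unfold next, good; simpl. repeat split; auto; lra.
    - exists (x + t / 2 * w, y). unfold next, good; simpl. repeat split; auto; lra.
    - exists (x, y + t / 2 * h). unfold next, good; simpl. repeat split; auto; lra.
    - exists (x + t / 2 * w, y + t / 2 * h). unfold next, good; simpl. repeat split; auto; lra. }
  set (st := fix st n := match n with O => (x0, y0) | S m => epsilon (inhabits (0, 0)) (next (st m) (/ 2 ^ m)) end).
  assert (Ht : forall n, 0 < / 2 ^ n) by (intros; apply Rinv_0_lt_compat, pow_lt; lra).
  assert (Ht2 : forall n, / 2 ^ n / 2 = / 2 ^ S n).
  { intros n. simpl. field. apply pow_nonzero. lra. }
  assert (Hg : forall n, good (st n) (/ 2 ^ n)).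
  { induction n as [|n IH].
    - unfold good; simpl. rewrite Rinv_1. repeat split; auto; lra.
    - destruct (epsilon_spec (inhabits (0, 0)) _ (Hnext _ _ (Ht n) IH)) as [G _].
      rewrite Ht2 in G. exact G. }
  assert (Hs : forall n, next (st n) (/ 2 ^ n) (st (S n))).
  { intros n. apply (epsilon_spec (inhabits (0, 0)) _ (Hnext _ _ (Ht n) (Hg n))). }
  assert (Htw : forall n k, 0 < k -> 0 < / 2 ^ n * k) by (intros; apply Rmult_lt_0_compat; auto).
  destruct (nested_intervals (fun n => fst (st n)) (fun n => fst (st n) + / 2 ^ n * w)) as [p Hp].
  { intros n. apply Hs. }
  { intros n. destruct (Hs n) as [_ [H _]]. rewrite <- Ht2. pose proof (Htw n w Hw). lra. }
  { intros n. pose proof (Htw n w Hw). lra. }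
  destruct (nested_intervals (fun n => snd (st n)) (fun n => snd (st n) + / 2 ^ n * h)) as [q Hq].
  { intros n. apply Hs. }
  { intros n. destruct (Hs n) as [_ [_ H]]. rewrite <- Ht2. pose proof (Htw n h Hh). lra. }
  { intros n. pose proof (Htw n h Hh). lra. }
  destruct (Hloc p q) as [d [Hd Hl]].
  { specialize (Hp O). simpl in Hp. rewrite Rinv_1 in Hp. lra. }
  destruct (pow_lt_1_zero (/ 2)) with d as [n Hn]; auto.
  { rewrite Rabs_pos_eq; lra. }
  specialize (Hn n (le_n n)). rewrite pow_inv in Hn. rewrite Rabs_pos_eq in Hn by (left; auto).
  destruct (Hg n) as [G1 [G2 G3]]. apply G1. apply Hl; auto.
Qed.

Lemma RInt_near_const (f : R -> R) a b c M : a <= b -> ex_RInt f a b ->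
  (forall s, a <= s <= b -> Rabs (f s - c) <= M) -> Rabs (RInt f a b - c * (b - a)) <= M * (b - a).
Proof.
  intros Hab Hf HM.
  replace (RInt f a b - c * (b - a)) with (RInt (fun s => f s - c) a b).
  - rewrite Rmult_comm. apply abs_RInt_le_const; auto.
    apply @ex_RInt_minus; auto. apply ex_RInt_const.
  - transitivity (minus (RInt f a b) (RInt (fun _ => c) a b)).
    + apply (RInt_minus f (fun _ => c)); auto. apply ex_RInt_const.
    + rewrite RInt_const. unfold minus, plus, opp, scal; simpl. unfold mult; simpl. ring.
Qed.

(* The imaginary part of the integral of [(u + i v) dz] along the boundary of [x, x + a] x [y, y + b]. *)
Definition rect_form (u v : R -> R -> R) (x y a b : R) : R :=
  RInt (fun s => v s y - v s (y + b)) x (x + a) + RInt (fun s => u (x + a) s - u x s) y (y + b).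

Section Goursat.

(** The domain is the half-plane [p < B] because the logarithm unrolls the punctured disc of radius
    [exp B] onto it. *)
Variables (u v : R -> R -> R) (B : R).

(* [u + i v] has complex derivative [al + i be] at [(p, q)]. *)
Hypothesis CR : forall p q, p < B -> exists al be, forall eps, 0 < eps -> exists delta, 0 < delta /\
  forall x y, Rabs (x - p) < delta -> Rabs (y - q) < delta ->
    Rabs (u x y - (u p q + al * (x - p) - be * (y - q))) <= eps * (Rabs (x - p) + Rabs (y - q)) /\
    Rabs (v x y - (v p q + be * (x - p) + al * (y - q))) <= eps * (Rabs (x - p) + Rabs (y - q)).

Lemma CR_continuous p q : p < B -> forall eps, 0 < eps -> exists delta, 0 < delta /\
  forall x y, Rabs (x - p) < delta -> Rabs (y - q) < delta ->
    Rabs (u x y - u p q) < eps /\ Rabs (v x y - v p q) < eps.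
Proof.
  intros Hp eps He. destruct (CR p q Hp) as [al [be H]].
  destruct (H 1 Rlt_0_1) as [d [Hd H1]].
  set (K := Rabs al + Rabs be + 1).
  assert (HK : 1 <= K) by (unfold K; pose proof (Rabs_pos al); pose proof (Rabs_pos be); lra).
  exists (Rmin d (eps / (4 * K))).
  split. { apply Rmin_pos; auto. apply Rdiv_lt_0_compat; lra. }
  intros x y Hx Hy.
  pose proof (Rmin_l d (eps / (4 * K))). pose proof (Rmin_r d (eps / (4 * K))).
  destruct (H1 x y) as [A1 A2]; try lra.
  assert (Hk : eps / (4 * K) * (4 * K) = eps) by (field; lra).
  pose proof (Rabs_pos (x - p)). pose proof (Rabs_pos (y - q)).
  pose proof (Rabs_pos al). pose proof (Rabs_pos be).
  set (X := Rabs (x - p)) in *. set (Y := Rabs (y - q)) in *.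
  assert (F1 : forall c, 0 <= c -> c <= K -> c * X <= K * X /\ c * Y <= K * Y).
  { intros c C0 C1. split; apply Rmult_le_compat_r; auto. }
  assert (K * (X + Y) < eps / 2 ).
  { apply Rlt_le_trans with (K * (2 * (eps / (4 * K)))).
    - apply Rmult_lt_compat_l; lra.
    - right. field. lra. }
  split.
  - replace (u x y - u p q) with ((u x y - (u p q + al * (x - p) - be * (y - q))) + (al * (x - p) + - (be * (y - q)))) by ring.
    eapply Rle_lt_trans; [apply Rabs_triang|].
    pose proof (Rabs_triang (al * (x - p)) (- (be * (y - q)))) as T.
    rewrite Rabs_Ropp, !Rabs_mult in T. fold X Y in T. unfold K in *. nra.
  - replace (v x y - v p q) with ((v x y - (v p q + be * (x - p) + al * (y - q))) + (be * (x - p) + (al * (y - q)))) by ring.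
    eapply Rle_lt_trans; [apply Rabs_triang|].
    pose proof (Rabs_triang (be * (x - p)) (al * (y - q))) as T.
    rewrite !Rabs_mult in T. fold X Y in T. unfold K in *. nra.
Qed.

Lemma continuous_of_eps (f : R -> R) x :
  (forall eps, 0 < eps -> exists delta, 0 < delta /\ forall y, Rabs (y - x) < delta -> Rabs (f y - f x) < eps) ->
  continuous f x.
Proof.
  intros H. apply filterlim_locally. intros eps. destruct (H eps (cond_pos eps)) as [d [Hd H1]].
  exists (mkposreal d Hd). intros y Hy. apply H1. exact Hy.
Qed.

Lemma CR_section_cont p q : p < B ->
  continuous (fun x => v x q) p /\ continuous (fun y => u p y) q.
Proof.
  intros Hp. split; apply continuous_of_eps; intros eps He;
  destruct (CR_continuous p q Hp eps He) as [d [Hd H]]; exists d; split; auto;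
  intros y Hy; apply H; auto; rewrite Rminus_diag, Rabs_R0; auto.
Qed.

Lemma CR_ex_RInt_v q a b : a < B -> b < B -> ex_RInt (fun x => v x q) a b.
Proof.
  intros Ha Hb. apply @ex_RInt_continuous. intros z Hz. apply CR_section_cont.
  destruct Hz as [_ Hz]. apply Rle_lt_trans with (1 := Hz). apply Rmax_lub_lt; auto.
Qed.

Lemma CR_ex_RInt_u p a b : p < B -> ex_RInt (fun y => u p y) a b.
Proof.
  intros Hp. apply @ex_RInt_continuous. intros z Hz. now apply CR_section_cont.
Qed.

Lemma CR_ex_RInt_dv q q' a b : a < B -> b < B -> ex_RInt (fun x => v x q - v x q') a b.
Proof. intros Ha Hb. apply @ex_RInt_minus; apply CR_ex_RInt_v; auto. Qed.

Lemma CR_ex_RInt_du p p' a b : p < B -> p' < B -> ex_RInt (fun y => u p y - u p' y) a b.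
Proof. intros Ha Hb. apply @ex_RInt_minus; apply CR_ex_RInt_u; auto. Qed.

Lemma RInt_sub_swap (f g h : R -> R) a b :
  ex_RInt (fun s => f s - g s) a b -> ex_RInt (fun s => g s - h s) a b ->
  RInt (fun s => f s - h s) a b = RInt (fun s => f s - g s) a b + RInt (fun s => g s - h s) a b.
Proof.
  intros H1 H2. rewrite <- (RInt_plus (fun s => f s - g s) (fun s => g s - h s)) by auto.
  apply RInt_ext. intros s _. unfold plus; simpl. ring.
Qed.

(** The integrals along the inner edges cancel: both middle lines are inserted by [RInt_sub_swap],
    and the edges are halved by [RInt_Chasles]. *)
Lemma rect_form_split x y a b : 0 < a -> x + (a + a) < B ->
  rect_form u v x y (a + a) (b + b) =
    rect_form u v x y a b + rect_form u v (x + a) y a b +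
    rect_form u v x (y + b) a b + rect_form u v (x + a) (y + b) a b.
Proof.
  intros Ha HB. unfold rect_form.
  replace (x + (a + a)) with (x + a + a) by ring. replace (y + (b + b)) with (y + b + b) by ring.
  rewrite (RInt_sub_swap (fun s => v s y) (fun s => v s (y + b)) (fun s => v s (y + b + b)))
    by (apply CR_ex_RInt_dv; lra).
  rewrite (RInt_sub_swap (fun s => u (x + a + a) s) (fun s => u (x + a) s) (fun s => u x s))
    by (apply CR_ex_RInt_du; lra).
  rewrite <- (RInt_Chasles (fun s => v s y - v s (y + b)) x (x + a) (x + a + a)) by (apply CR_ex_RInt_dv; lra).
  rewrite <- (RInt_Chasles (fun s => v s (y + b) - v s (y + b + b)) x (x + a) (x + a + a)) by (apply CR_ex_RInt_dv; lra).
  rewrite <- (RInt_Chasles (fun s => u (x + a + a) s - u (x + a) s) y (y + b) (y + b + b)) by (apply CR_ex_RInt_du; lra).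
  rewrite <- (RInt_Chasles (fun s => u (x + a) s - u x s) y (y + b) (y + b + b)) by (apply CR_ex_RInt_du; lra).
  unfold plus; simpl. ring.
Qed.

(** A bound quadratic in the side lengths passes from four quarters to the whole. Near a point of
    differentiability it holds, because the affine part of the function integrates to 0 and the
    remainder is small compared with the side lengths. *)
Lemma goursat x y a b : 0 < a -> 0 < b -> x + a < B -> rect_form u v x y a b = 0.
Proof.
  intros Ha Hb HB.
  assert (Main : forall eps, 0 < eps -> Rabs (rect_form u v x y a b) <= eps * ((a + b) * (a + b))).
  { intros eps He.
    pose (P := fun x y t => Rabs (rect_form u v x y (t * a) (t * b)) <= eps * ((t * (a + b)) * (t * (a + b)))).
    assert (HP : P x y 1).
    { apply quartering_induction with a b; auto.
      - intros x' y' t Ht X1 X2 H1 H2 H3 H4. unfold P in *.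
        assert (0 < t * a) by (apply Rmult_lt_0_compat; auto).
        replace (t * a) with (t / 2 * a + t / 2 * a) by field.
        replace (t * b) with (t / 2 * b + t / 2 * b) by field.
        rewrite rect_form_split by lra.
        eapply Rle_trans; [apply Rabs_triang|].
        eapply Rle_trans; [apply Rplus_le_compat_r, Rabs_triang|].
        eapply Rle_trans; [apply Rplus_le_compat_r, Rplus_le_compat_r, Rabs_triang|].
        replace (eps * (t * (a + b) * (t * (a + b)))) with
          (4 * (eps * (t / 2 * (a + b) * (t / 2 * (a + b))))) by field. lra.
      - intros p q Hp. destruct (CR p q ltac:(lra)) as [al [be H]].
        destruct (H (eps / 4) ltac:(lra)) as [d [Hd H1]].
        exists (d / (a + b)). split. { apply Rdiv_lt_0_compat; lra. }
        intros x' y' t Ht X1 X2 HX HY. unfold P.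
        assert (Htd : t * (a + b) < d).
        { apply Rlt_le_trans with (d / (a + b) * (a + b)).
          - apply Rmult_lt_compat_r; lra.
          - right. field. lra. }
        assert (Hta : 0 < t * a) by (apply Rmult_lt_0_compat; lra).
        assert (Htb : 0 < t * b) by (apply Rmult_lt_0_compat; lra).
        set (A := t * a) in *. set (D := t * b) in *.
        replace (t * (a + b)) with (A + D) in * by (unfold A, D; ring).
        assert (Hpt : forall s r, x' <= s <= x' + A -> y' <= r <= y' + D ->
           Rabs (u s r - (u p q + al * (s - p) - be * (r - q))) <= eps / 4 * (A + D) /\
           Rabs (v s r - (v p q + be * (s - p) + al * (r - q))) <= eps / 4 * (A + D)).
        { intros s r Hs Hr.
          assert (Rabs (s - p) <= A) by (apply Rabs_le; lra).
          assert (Rabs (r - q) <= D) by (apply Rabs_le; lra).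
          assert (eps / 4 * (Rabs (s - p) + Rabs (r - q)) <= eps / 4 * (A + D)).
          { apply Rmult_le_compat_l; lra. }
          destruct (H1 s r); lra. }
        unfold rect_form.
        (* The affine parts of the two integrands are [- al * D] and [al * A], the terms with [be]
           dropping out of the differences; after multiplication by the lengths [A] and [D] they
           cancel. *)
        assert (N1 : Rabs (RInt (fun s => v s y' - v s (y' + D)) x' (x' + A) - (- al * D) * (x' + A - x')) <= eps / 2 * (A + D) * (x' + A - x')).
        { apply RInt_near_const; [lra| |].
          - apply CR_ex_RInt_dv; lra.
          - intros s Hs. destruct (Hpt s y') as [_ A1]; try lra. destruct (Hpt s (y' + D)) as [_ A2]; try lra.
            apply Rabs_le_between in A1. apply Rabs_le_between in A2. apply Rabs_le. lra. }
        assert (N2 : Rabs (RInt (fun s => u (x' + A) s - u x' s) y' (y' + D) - (al * A) * (y' + D - y')) <= eps / 2 * (A + D) * (y' + D - y')).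
        { apply RInt_near_const; [lra| |].
          - apply CR_ex_RInt_du; lra.
          - intros s Hs. destruct (Hpt x' s) as [A1 _]; try lra. destruct (Hpt (x' + A) s) as [A2 _]; try lra.
            apply Rabs_le_between in A1. apply Rabs_le_between in A2. apply Rabs_le. lra. }
        apply Rabs_le_between in N1. apply Rabs_le_between in N2. apply Rabs_le.
        replace (x' + A - x') with A in * by ring. replace (y' + D - y') with D in * by ring.
        assert (0 < eps * ((A + D) * (A + D))) by (repeat apply Rmult_lt_0_compat; lra).
        lra. }
    unfold P in HP. rewrite !Rmult_1_l in HP. exact HP. }
  apply NNPP. intros N. apply Rabs_pos_lt in N.
  set (r := Rabs (rect_form u v x y a b)) in *.
  assert (Hq : 0 < (a + b) * (a + b)) by (apply Rmult_lt_0_compat; lra).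
  specialize (Main (r / (2 * ((a + b) * (a + b)))) ltac:(apply Rdiv_lt_0_compat; lra)).
  replace (r / (2 * ((a + b) * (a + b))) * ((a + b) * (a + b))) with (r / 2) in Main by (field; lra).
  lra.
Qed.

End Goursat.
(** * Maximum principle and zeros of entire functions *)

(** This is the chain rule for the function [K (z0 + cexp zeta)] of [zeta]; [al] and [be] are the
    real and imaginary parts of its derivative at [(p, q)]. *)
Lemma punctured_disc_CR (K : C -> C) (z0 : C) (r' : R) : 0 < r' ->
  (forall z, 0 < Cmod (z - z0) < r' -> exists l, has_cderiv K z l) ->
  forall p q, p < ln r' -> exists al be : R, forall eps, 0 < eps -> exists delta, 0 < delta /\
    forall x y, Rabs (x - p) < delta -> Rabs (y - q) < delta ->
    Rabs (fst (K (z0 + cexp (x, y))%C) - (fst (K (z0 + cexp (p, q))%C) + al * (x - p) - be * (y - q)))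
      <= eps * (Rabs (x - p) + Rabs (y - q)) /\
    Rabs (snd (K (z0 + cexp (x, y))%C) - (snd (K (z0 + cexp (p, q))%C) + be * (x - p) + al * (y - q)))
      <= eps * (Rabs (x - p) + Rabs (y - q)).
Proof.
  intros Hr' HK p q Hp.
  assert (Hpos : 0 < Cmod (z0 + cexp (p, q) - z0)%C < r').
  { replace (z0 + cexp (p, q) - z0)%C with (cexp (p, q)) by ring. rewrite Cmod_cexp. simpl.
    split; [apply exp_pos|]. rewrite <- (exp_ln r') by auto. now apply exp_increasing. }
  destruct (HK _ Hpos) as [l0 Hl0].
  pose (g := fun z => K (z0 + cexp z)%C).
  assert (Hg : has_cderiv g (p, q) (l0 * (0 + cexp (p, q)))%C).
  { unfold g. apply cderiv_comp with (f := fun z => (z0 + cexp z)%C); auto.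
    apply cderiv_plus; [apply cderiv_const|apply cderiv_cexp]. }
  set (l := (l0 * (0 + cexp (p, q)))%C) in *.
  exists (fst l), (snd l). intros eps He.
  destruct (eps_of_cderiv _ _ _ Hg eps He) as [d [Hd H]].
  exists (d / 2). split; [lra|]. intros x y Hx Hy.
  assert (Hxy : Cmod ((x, y) - (p, q)) <= Rabs (x - p) + Rabs (y - q)) by apply (Cmod_le_Rabs (x - p) (y - q)).
  specialize (H (x, y) ltac:(lra)).
  assert (A : eps * Cmod ((x, y) - (p, q)) <= eps * (Rabs (x - p) + Rabs (y - q))) by (apply Rmult_le_compat_l; lra).
  split; (eapply Rle_trans; [|exact A]); (eapply Rle_trans; [|exact H]).
  - eapply Rle_trans; [|apply Rabs_fst_le]. right. f_equal. unfold g; simpl. ring.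
  - eapply Rle_trans; [|apply Rabs_snd_le]. right. f_equal. unfold g; simpl. ring.
Qed.

(* In the coordinate [zeta = log (z - z0)], Goursat's theorem on rectangles of height [2 PI] says that the
   mean of [Re K] over circles about [z0] does not depend on the radius; let the radius tend to 0. *)
Lemma circle_mean_not_below (K : C -> C) (z0 : C) (r r' c : R) :
  0 < r < r' -> 0 < c -> ccont K z0 ->
  (forall z, 0 < Cmod (z - z0) < r' -> exists l, has_cderiv K z l) ->
  ~ (forall z, Cmod (z - z0) = r -> fst (K z) <= fst (K z0) - c).
Proof.
  intros Hr Hc Hcont HK Hcirc.
  set (u := fun x y => fst (K (z0 + cexp (x, y))%C)).
  set (v := fun x y => snd (K (z0 + cexp (x, y))%C)).
  pose proof (punctured_disc_CR K z0 r' ltac:(lra) HK) as CR. fold u v in CR.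
  assert (Hcirc' : forall x y, Cmod (z0 + cexp (x, y) - z0) = exp x).
  { intros x y. replace (z0 + cexp (x, y) - z0)%C with (cexp (x, y)) by ring. apply Cmod_cexp. }
  destruct (Hcont (c / 2)) as [d [Hd Hd1]]; [lra|].
  (* The edge [a] corresponds to a circle so small that [K] differs there from [K z0] by less than
     [c / 2], the edge [b] to the circle of radius [r]. *)
  set (b := ln r). set (a := Rmin (ln (d / 2)) (b - 1)).
  assert (Hab : a < b). { unfold a. pose proof (Rmin_r (ln (d / 2)) (b - 1)). lra. }
  assert (HbB : b < ln r') by (apply ln_increasing; lra).
  assert (Hea : exp a < d).
  { apply Rle_lt_trans with (d / 2); [|lra]. rewrite <- (exp_ln (d / 2)) by lra.
    assert (Hle : a <= ln (d / 2)) by apply Rmin_l.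
    destruct Hle as [Hle| ->]; [left; now apply exp_increasing|lra]. }
  pose proof PI_RGT_0 as HPI.
  pose proof (goursat u v (ln r') CR a 0 (b - a) (2 * PI) ltac:(lra) ltac:(lra) ltac:(lra)) as G.
  unfold rect_form in G. replace (a + (b - a)) with b in G by ring.
  (* The horizontal edges cancel, being a full period [2 * PI] of [cexp] apart. *)
  replace (RInt (fun s => v s 0 - v s (0 + 2 * PI)) a b) with 0 in G.
  2: { symmetry. transitivity (RInt (fun _ => 0) a b).
    - apply RInt_ext. intros s _. unfold v, cexp; simpl. rewrite cos_plus, sin_plus, cos_2PI, sin_2PI, cos_0, sin_0.
      replace (1 * 1 - 0 * 0) with 1 by ring. replace (0 * 1 + 1 * 0) with 0 by ring. ring.
    - rewrite RInt_const. apply Rmult_0_r. }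
  (* [u] is at most [fst (K z0) - c] on the edge [b] and above [fst (K z0) - c / 2] on the edge [a];
     so the remaining integral is negative, against Goursat. *)
  assert (L : RInt (fun s => u b s - u a s) 0 (0 + 2 * PI) <= RInt (fun _ => - (c / 2)) 0 (0 + 2 * PI)).
  { apply RInt_le; [lra| |apply ex_RInt_const|].
    - apply (CR_ex_RInt_du u v (ln r')); auto; lra.
    - intros s _.
      assert (A1 : u b s <= fst (K z0) - c).
      { apply Hcirc. rewrite Hcirc'. apply exp_ln; lra. }
      assert (A2 : Rabs (u a s - fst (K z0)) < c / 2).
      { eapply Rle_lt_trans; [apply (Rabs_fst_le (K (z0 + cexp (a, s)) - K z0)%C)|].
        apply Hd1. rewrite Hcirc'. exact Hea. }
      apply Rabs_lt_between in A2. lra. }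
  rewrite RInt_const in L. unfold scal in L; simpl in L. unfold mult in L; simpl in L.
  assert (0 < (0 + 2 * PI - 0) * (c / 2)) by (apply Rmult_lt_0_compat; lra). lra.
Qed.

(** * Compactness of closed discs *)

Lemma disc_uniform (rho : R) (Q : R -> C -> Prop) :
  (forall m m' z, 0 < m' <= m -> Q m z -> Q m' z) ->
  (forall w, Cmod w <= rho -> exists m, 0 < m /\ forall z, Cmod (z - w) < m -> Cmod z <= rho -> Q m z) ->
  exists m, 0 < m /\ forall z, Cmod z <= rho -> Q m z.
Proof.
  intros Hanti Hloc.
  assert (H : forall w, exists m : posreal, forall z, Cmod (z - w) < m -> Cmod z <= rho -> Q m z).
  { intros w. destruct (Rle_dec (Cmod w) rho) as [h|h].
    - destruct (Hloc w h) as [m [Hm H]]. now exists (mkposreal m Hm).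
    - assert (Hp : 0 < Cmod w - rho) by lra. exists (mkposreal _ Hp). simpl. intros z Hz Hz'.
      pose proof (Cmod_le_sub w z). rewrite Cmod_minus_sym in H. lra. }
  set (g := fun w => proj1_sig (constructive_indefinite_description _ (H w))).
  assert (Hg : forall w z, Cmod (z - w) < g w -> Cmod z <= rho -> Q (g w) z).
  { intros w. exact (proj2_sig (constructive_indefinite_description _ (H w))). }
  (* The gauge is halved because a square of half-side [g / 2] fits into the disc of radius [g]. *)
  destruct (compactness_value_2d (- rho) rho (- rho) rho (fun x y => pos_div_2 (g (x, y)))) as [d Hd].
  exists d. split; [apply cond_pos|]. intros [x y] Hz.
  pose proof (Rabs_fst_le (x, y)) as Hx. pose proof (Rabs_snd_le (x, y)) as Hy. simpl in Hx, Hy.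
  specialize (Hd x y ltac:(apply Rabs_le_between; lra) ltac:(apply Rabs_le_between; lra)).
  apply NNPP in Hd. destruct Hd as [s [t [_ [_ [H1 [H2 H3]]]]]]. simpl in H1, H2, H3.
  pose proof (cond_pos (g (s, t))). pose proof (cond_pos d).
  apply Hanti with (g (s, t)); [lra|]. apply Hg; auto.
  apply Rle_lt_trans with (1 := Cmod_le_Rabs (x - s) (y - t)). lra.
Qed.

Lemma disc_bounded (f : C -> C) (rho : R) : (forall z, ccont f z) ->
  exists M, 0 < M /\ forall z, Cmod z <= rho -> Cmod (f z) <= M.
Proof.
  (* The bound enters as [/ m], so that decreasing [m] weakens the property, as [disc_uniform]
     demands. *)
  intros Hf. destruct (disc_uniform rho (fun m z => Cmod (f z) <= / m)) as [m [Hm H]].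
  - intros m m' z Hm H. eapply Rle_trans; [exact H|]. apply Rinv_le_contravar; lra.
  - intros w _. destruct (Hf w 1 Rlt_0_1) as [d [Hd H]].
    pose proof (Cmod_ge_0 (f w)).
    exists (Rmin d (/ (Cmod (f w) + 1))). assert (0 < / (Cmod (f w) + 1)) by (apply Rinv_0_lt_compat; lra).
    split. { apply Rmin_pos; auto. }
    intros z Hz _. pose proof (Rmin_l d (/ (Cmod (f w) + 1))). pose proof (Rmin_r d (/ (Cmod (f w) + 1))).
    specialize (H z ltac:(lra)). pose proof (Cmod_le_sub (f z) (f w)).
    apply Rle_trans with (/ / (Cmod (f w) + 1)).
    + rewrite Rinv_inv. lra.
    + apply Rinv_le_contravar; auto. apply Rmin_pos; auto.
  - exists (/ m). split; auto. now apply Rinv_0_lt_compat.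
Qed.

Lemma disc_max (V : C -> R) (rho : R) : 0 <= rho ->
  (forall w eps, 0 < eps -> exists d, 0 < d /\ forall z, Cmod (z - w) < d -> Rabs (V z - V w) < eps) ->
  exists z0, Cmod z0 <= rho /\ forall z, Cmod z <= rho -> V z <= V z0.
Proof.
  intros Hrho HV.
  destruct (disc_bounded (fun z => RtoC (V z)) rho) as [M [_ HM]].
  { intros w eps He. destruct (HV w eps He) as [d [Hd H]]. exists d. split; auto.
    intros y Hy. replace (RtoC (V y) - RtoC (V w))%C with (RtoC (V y - V w)) by (unfold RtoC, Cminus, Cplus, Copp; simpl; f_equal; ring).
    rewrite Cmod_R. auto. }
  destruct (completeness (fun x => exists z, Cmod z <= rho /\ x = V z)) as [s [S1 S2]].
  - exists M. intros x [z [Hz ->]]. eapply Rle_trans; [apply Rle_abs|]. rewrite <- Cmod_R. auto.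
  - exists (V 0%C), 0%C. rewrite Cmod_0. auto.
  - apply NNPP. intros N.
    assert (HS : forall w, Cmod w <= rho -> V w < s).
    { intros w Hw. destruct (Rle_lt_or_eq_dec (V w) s) as [|e]; auto.
      - apply S1. now exists w.
      - exfalso. apply N. exists w. split; auto. intros z Hz. rewrite e. apply S1. now exists z. }
    destruct (disc_uniform rho (fun m z => V z <= s - m)) as [m [Hm H]].
    + intros; lra.
    + intros w Hw. specialize (HS w Hw). destruct (HV w ((s - V w) / 2)) as [d [Hd H]]; [lra|].
      exists (Rmin d ((s - V w) / 2)). split. { apply Rmin_pos; lra. }
      intros z Hz _. pose proof (Rmin_l d ((s - V w) / 2)). pose proof (Rmin_r d ((s - V w) / 2)).
      specialize (H z ltac:(lra)). apply Rabs_lt_between in H. lra.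
    + assert (s <= s - m); [|lra]. apply S2. intros x [z [Hz ->]]. auto.
Qed.

Lemma list_separated (S : list C) (z0 : C) :
  exists r, 0 < r /\ forall s, In s S -> s <> z0 -> r <= Cmod (s - z0).
Proof.
  induction S as [|a S [r [Hr IH]]].
  - exists 1. split; [lra|]. intros s [].
  - destruct (classic (a = z0)) as [->|n].
    + exists r. split; auto. intros s [->|H] H'; [now destruct H'|auto].
    + exists (Rmin r (Cmod (a - z0))). split. { apply Rmin_pos; auto. now apply Cmod_sub_pos. }
      intros s [->|H] H'; [apply Rmin_r|]. eapply Rle_trans; [apply Rmin_l|auto].
Qed.

Lemma Cmod_sqr (z : C) : Cmod z * Cmod z = fst z * fst z + snd z * snd z.
Proof. pose proof (Cmod2_alt z) as H. unfold Re, Im in H. simpl in H. lra. Qed.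

(* Adding [eps |z|^2] moves the maximum into the interior; the first-order part of this term at the maximum
   [z0] is absorbed into the holomorphic function [K'], and its second-order part contradicts the mean value
   property of [K']. *)
Lemma re_maximum_principle (K : C -> C) (S : list C) (rho M : R) : 0 <= rho ->
  (forall z, ccont K z) -> (forall z, ~ In z S -> exists l, has_cderiv K z l) ->
  (forall z, Cmod z = rho -> fst (K z) <= M) -> forall z, Cmod z <= rho -> fst (K z) <= M.
Proof.
  intros Hrho Hcont HS HM z1 Hz1. apply Rnot_lt_le. intros Hlt.
  (* On the circle the added term is at most half the excess of [fst (K z1)] over [M], so the
     maximum of [V] is not attained there. *)
  set (eps := (fst (K z1) - M) / (2 * (rho * rho + 1))).
  assert (Hrr : 0 <= rho * rho) by (apply Rmult_le_pos; auto).
  assert (He : 0 < eps) by (apply Rdiv_lt_0_compat; lra).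
  assert (Hee : eps * (rho * rho + 1) = (fst (K z1) - M) / 2) by (unfold eps; field; lra).
  pose (V := fun z : C => fst (K z + eps * (z * Cconj z))%C).
  assert (HVE : forall z, V z = fst (K z) + eps * (Cmod z * Cmod z)).
  { intros z. rewrite Cmod_sqr. unfold V; simpl. ring. }
  assert (Hconj : forall z, ccont Cconj z).
  { intros z e H. exists e. split; auto. intros y Hy.
    replace (Cconj y - Cconj z)%C with (Cconj (y - z)) by (unfold Cconj, Cminus, Cplus, Copp; simpl; f_equal; ring).
    now rewrite Cmod_conj. }
  destruct (disc_max V rho Hrho) as [z0 [Hz0 Hmax]].
  { intros w e H.
    assert (Hc : ccont (fun z => K z + eps * (z * Cconj z))%C w).
    { apply ccont_plus; auto. apply ccont_mult; [apply ccont_const|]. apply ccont_mult; auto using ccont_id. }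
    destruct (Hc e H) as [d [Hd H1]]. exists d. split; auto. intros z Hz.
    eapply Rle_lt_trans; [|apply (H1 z Hz)].
    eapply Rle_trans; [|apply Rabs_fst_le]. right. f_equal. }
  assert (Hin : Cmod z0 < rho).
  { destruct Hz0 as [|e]; auto. exfalso.
    specialize (Hmax z1 Hz1). rewrite !HVE, e in Hmax.
    pose proof (HM z0 e). pose proof (Cmod_ge_0 z1).
    assert (0 <= eps * (Cmod z1 * Cmod z1)) by (apply Rmult_le_pos; [lra|apply Rmult_le_pos; auto]). lra. }
  destruct (list_separated S z0) as [r0 [Hr0 Hsep]].
  set (r' := Rmin r0 (rho - Cmod z0)).
  assert (Hr' : 0 < r') by (apply Rmin_pos; lra).
  (* Since [|z|^2 = |z - z0|^2 + 2 Re (conj z0 * z) - |z0|^2], maximality of [V] at [z0] gives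
     [Re (K' z) <= Re (K' z0) - eps |z - z0|^2] in the disc. *)
  pose (K' := fun z => (K z + (2 * eps * Cconj z0) * z)%C).
  apply (circle_mean_not_below K' z0 (r' / 2) r' (eps * (r' / 2 * (r' / 2)))).
  - lra.
  - apply Rmult_lt_0_compat; [lra|]. apply Rmult_lt_0_compat; lra.
  - apply ccont_plus; auto. apply ccont_mult; [apply ccont_const|apply ccont_id].
  - intros z Hz. destruct (HS z) as [l Hl].
    + intros Hin'. assert (r0 <= Cmod (z - z0)).
      { apply Hsep; auto. intros ->. rewrite Cmod_sub_diag in Hz. lra. }
      assert (r' <= r0) by apply Rmin_l. lra.
    + eexists. apply cderiv_plus; [exact Hl|]. apply cderiv_scal, cderiv_id.
  - intros z Hz.
    assert (Hzr : Cmod z <= rho).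
    { pose proof (Cmod_le_sub z z0). assert (r' <= rho - Cmod z0) by apply Rmin_r. lra. }
    specialize (Hmax z Hzr). rewrite !HVE, !Cmod_sqr in Hmax.
    rewrite <- Hz, Cmod_sqr. unfold K'. destruct z as [x y], z0 as [x0 y0]. simpl in *. nra.
Qed.

(** A rotation [c] turns the value at the given point into its modulus, and the statement on real
    parts applies to [c * K]. *)
Lemma maximum_principle (K : C -> C) (S : list C) (rho M : R) : 0 <= rho ->
  (forall z, ccont K z) -> (forall z, ~ In z S -> exists l, has_cderiv K z l) ->
  (forall z, Cmod z = rho -> Cmod (K z) <= M) -> forall z, Cmod z <= rho -> Cmod (K z) <= M.
Proof.
  intros Hrho Hcont HS HM z Hz.
  destruct (classic (K z = 0%C)) as [e|n].
  - rewrite e, Cmod_0. eapply Rle_trans; [apply Cmod_ge_0|]. apply (HM (RtoC rho)).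
    rewrite Cmod_R. now apply Rabs_pos_eq.
  - set (c := (RtoC (Cmod (K z)) / K z)%C).
    assert (Hc : Cmod c = 1).
    { unfold c. rewrite Cmod_div by auto. rewrite Cmod_R, Rabs_pos_eq by apply Cmod_ge_0.
      field. apply Rgt_not_eq. now apply Cmod_pos. }
    replace (Cmod (K z)) with (fst (c * K z)%C).
    + apply (re_maximum_principle (fun z => c * K z)%C S rho M); auto.
      * intros w. apply ccont_mult; auto using ccont_const.
      * intros w Hw. destruct (HS w Hw) as [l Hl]. eexists. apply cderiv_scal, Hl.
      * intros w Hw. eapply Rle_trans; [apply Rle_abs|]. eapply Rle_trans; [apply Rabs_fst_le|].
        rewrite Cmod_mult, Hc, Rmult_1_l. auto.
    + replace (c * K z)%C with (RtoC (Cmod (K z))). { reflexivity. }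
      unfold c. field. auto.
Qed.

(** [phi] is the difference quotient of [K] at [w]. At [w] only its continuity is kept, so [w] joins
    the exceptional list; this is why the maximum principle tolerates such a list. *)
Lemma quotient_regular (K phi : C -> C) (w : C) (S : list C) :
  (forall z, ccont K z) -> (forall z, ~ In z S -> exists l, has_cderiv K z l) ->
  ccont phi w -> (forall z, K z = (K w + phi z * (z - w))%C) ->
  (forall z, ccont phi z) /\ (forall z, ~ In z (w :: S) -> exists l, has_cderiv phi z l).
Proof.
  intros Hcont HS Hw HE.
  assert (Hq : forall z, z <> w -> forall y, Cmod (y - z) < Cmod (z - w) ->
     ((K y - K w) * / (y - w))%C = phi y).
  { intros z Hz y Hy. assert (y <> w). { intros ->. rewrite Cmod_minus_sym in Hy. lra. }
    rewrite (HE y). field. now apply Cminus_neq_0. }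
  split.
  - intros z. destruct (classic (z = w)) as [->|n]; auto.
    apply ccont_ext_loc with (2 := Hq z n). { now apply Cmod_sub_pos. }
    apply ccont_mult.
    + apply ccont_plus; auto using ccont_const.
    + apply ccont_comp with (f := fun y => (y - w)%C) (g := Cinv).
      * apply ccont_plus; auto using ccont_const, ccont_id.
      * apply ccont_inv. now apply Cminus_neq_0.
  - intros z Hz. assert (n : z <> w) by (intros ->; apply Hz; now left).
    destruct (HS z) as [l Hl]. { intros H. apply Hz. now right. }
    destruct (cderiv_inv (z - w)%C (Cminus_neq_0 _ _ n)) as [l' Hl'].
    eexists. apply cderiv_ext_loc with (2 := Hq z n). { now apply Cmod_sub_pos. }
    apply cderiv_mult.
    + apply cderiv_minus; [exact Hl|apply cderiv_const].
    + apply cderiv_comp with (f := fun y => (y - w)%C) (g := Cinv); [|exact Hl'].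
      apply cderiv_minus; [apply cderiv_id|apply cderiv_const].
Qed.

(** A Cauchy estimate without integrals: on [|z| = R1 + 1] the denominator [z - w] has modulus at
    least 1 and the numerator at most [2 * M], and the maximum principle carries the bound inwards,
    up to [phi w = l]. *)
Lemma slope_bound (f : C -> C) (w l : C) (R1 M : R) : entire f -> Cmod w <= R1 ->
  (forall z, Cmod z <= R1 + 1 -> Cmod (f z) <= M) -> has_cderiv f w l ->
  exists phi, phi w = l /\ (forall z, f z = (f w + phi z * (z - w))%C) /\
    forall z, Cmod z <= R1 + 1 -> Cmod (phi z) <= 2 * M.
Proof.
  intros Hf Hw HM Hl. destruct (cderiv_slope _ _ _ Hl) as [phi [P1 [P2 P3]]].
  exists phi. split; [auto|split; auto].
  destruct (quotient_regular f phi w nil) as [Q1 Q2]; auto.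
  { now apply entire_cont. }
  pose proof (Cmod_ge_0 w).
  apply (maximum_principle phi (w :: nil)); auto; [lra|].
  intros z Hz.
  pose proof (Cmod_le_sub z w).
  assert (1 * Cmod (phi z) <= Cmod (z - w) * Cmod (phi z)).
  { apply Rmult_le_compat_r; [apply Cmod_ge_0|lra]. }
  rewrite <- Cmod_mult in H1.
  replace ((z - w) * phi z)%C with (f z - f w)%C in H1 by (rewrite (P3 z); ring).
  pose proof (Cmod_minus_le (f z) (f w)). pose proof (HM z ltac:(lra)). pose proof (HM w ltac:(lra)). lra.
Qed.

Lemma cderiv_bound (f : C -> C) (w l : C) (R1 M : R) : entire f -> Cmod w <= R1 ->
  (forall z, Cmod z <= R1 + 1 -> Cmod (f z) <= M) -> has_cderiv f w l -> Cmod l <= 2 * M.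
Proof.
  intros Hf Hw HM Hl. destruct (slope_bound f w l R1 M Hf Hw HM Hl) as [phi [<- [_ H]]]. apply H. lra.
Qed.

Lemma entire_lipschitz (f : C -> C) (R1 M : R) (z w : C) : entire f -> Cmod w <= R1 -> Cmod z <= R1 + 1 ->
  (forall z, Cmod z <= R1 + 1 -> Cmod (f z) <= M) -> Cmod (f z - f w) <= 2 * M * Cmod (z - w).
Proof.
  intros Hf Hw Hz HM. destruct (Hf w) as [l Hl].
  destruct (slope_bound f w l R1 M Hf Hw HM Hl) as [phi [_ [E H]]].
  rewrite (E z). replace (f w + phi z * (z - w) - f w)%C with (phi z * (z - w))%C by ring.
  rewrite Cmod_mult. apply Rmult_le_compat_r; [apply Cmod_ge_0|auto].
Qed.

Definition root_prod (l : list C) (z : C) : C := fold_right (fun w acc => (z - w) * acc)%C (RtoC 1) l.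

Lemma root_prod_ge (l : list C) (z : C) (m : R) : 0 <= m -> (forall w, In w l -> m <= Cmod (z - w)) ->
  m ^ length l <= Cmod (root_prod l z).
Proof.
  intros Hm. induction l as [|a l IH]; intros H; simpl.
  - rewrite Cmod_1. lra.
  - rewrite Cmod_mult. apply Rmult_le_compat; auto using pow_le.
    + apply H. now left.
    + apply IH. intros w Hw. apply H. now right.
Qed.

Lemma root_prod_le (l : list C) (z : C) (m : R) : (forall w, In w l -> Cmod (z - w) <= m) ->
  Cmod (root_prod l z) <= m ^ length l.
Proof.
  induction l as [|a l IH]; intros H; simpl.
  - rewrite Cmod_1. lra.
  - rewrite Cmod_mult. apply Rmult_le_compat; auto using Cmod_ge_0.
    + apply H. now left.
    + apply IH. intros w Hw. apply H. now right.
Qed.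

Lemma root_prod_neq_0 (l : list C) (z : C) : ~ In z l -> root_prod l z <> 0%C.
Proof.
  induction l as [|a l IH]; intros H; simpl.
  - apply C1_nz.
  - apply Cmult_neq_0.
    + apply Cminus_neq_0. intros ->. apply H. now left.
    + apply IH. intros H'. apply H. now right.
Qed.

(** Roots are divided out one at a time. As they are distinct, the next root is off the exceptional
    list of the current quotient, which is therefore differentiable there and can be divided
    again. *)
Lemma factor_roots (f : C -> C) (l : list C) : entire f -> NoDup l -> (forall w, In w l -> f w = 0%C) ->
  exists K, (forall z, ccont K z) /\ (forall z, ~ In z l -> exists d, has_cderiv K z d) /\
    forall z, f z = (root_prod l z * K z)%C.
Proof.
  intros Hf. induction l as [|a l IH]; intros ND H0.
  - exists f. split; [now apply entire_cont|]. split; auto. intros z; simpl. ring.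
  - inversion ND as [|? ? Ha ND']; subst.
    destruct IH as [K [K1 [K2 K3]]]; auto. { intros w Hw. apply H0. now right. }
    assert (Ka : K a = 0%C).
    { pose proof (H0 a (or_introl eq_refl)) as E. rewrite K3 in E.
      destruct (classic (K a = 0%C)) as [|n]; auto. exfalso.
      revert E. apply Cmult_neq_0; auto. now apply root_prod_neq_0. }
    destruct (K2 a Ha) as [d Hd]. destruct (cderiv_slope _ _ _ Hd) as [phi [P1 [P2 P3]]].
    destruct (quotient_regular K phi a l K1 K2 P1 P3) as [Q1 Q2].
    exists phi. split; auto. split; auto.
    intros z. rewrite K3, (P3 z), Ka. simpl. ring.
Qed.

(* On [|z| = 5 R1] the factors [z - w] have modulus at least [4 R1], whereas at [z0] it is at most [2 R1]. *)
Lemma zero_count_bound (f : C -> C) (l : list C) (R1 M : R) (z0 : C) : entire f -> 0 < R1 -> NoDup l ->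
  (forall w, In w l -> f w = 0%C /\ Cmod w <= R1) -> Cmod z0 <= R1 ->
  (forall z, Cmod z <= 5 * R1 -> Cmod (f z) <= M) -> Cmod (f z0) * 2 ^ length l <= M.
Proof.
  intros Hf HR ND Hl Hz0 HM.
  destruct (factor_roots f l Hf ND) as [K [K1 [K2 K3]]]. { intros w Hw. now apply Hl. }
  set (n := length l).
  assert (HB : 0 < (2 * R1) ^ n) by (apply pow_lt; lra).
  assert (H2 : 0 < 2 ^ n) by (apply pow_lt; lra).
  assert (HK : Cmod (K z0) <= M / (2 ^ n * (2 * R1) ^ n)).
  { apply (maximum_principle K l (5 * R1)); auto; [lra| |lra].
    intros z Hz. apply Rmult_le_reg_l with ((2 * (2 * R1)) ^ n). { apply pow_lt; lra. }
    rewrite (Rpow_mult_distr 2) at 2.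
    replace (2 ^ n * (2 * R1) ^ n * (M / (2 ^ n * (2 * R1) ^ n))) with M by (field; lra).
    apply Rle_trans with (Cmod (root_prod l z) * Cmod (K z)).
    - apply Rmult_le_compat_r; [apply Cmod_ge_0|]. apply root_prod_ge; [lra|].
      intros w Hw. pose proof (Cmod_le_sub z w). destruct (Hl w Hw). lra.
    - rewrite <- Cmod_mult, <- K3. apply HM. lra. }
  rewrite K3, Cmod_mult.
  assert (HP : Cmod (root_prod l z0) <= (2 * R1) ^ n).
  { apply root_prod_le. intros w Hw. pose proof (Cmod_minus_le z0 w). destruct (Hl w Hw). lra. }
  apply Rle_trans with ((2 * R1) ^ n * (M / (2 ^ n * (2 * R1) ^ n)) * 2 ^ n).
  - apply Rmult_le_compat_r; [lra|]. apply Rmult_le_compat; auto using Cmod_ge_0.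
  - right. field. lra.
Qed.

(** The estimate in [zero_count_bound] involves only a bound on a larger disc and the value at one
    point [z0], and both survive a small perturbation of [f]. *)
Lemma zero_count_stable (f : C -> C) (R1 : R) (z0 : C) : entire f -> 0 < R1 -> Cmod z0 <= R1 -> f z0 <> 0%C ->
  exists (N : nat) (delta : R), 0 < delta /\ forall g, entire g ->
    (forall z, Cmod z <= 5 * R1 -> Cmod (g z - f z) < delta) ->
    forall l, NoDup l -> (forall w, In w l -> g w = 0%C /\ Cmod w <= R1) -> (length l <= N)%nat.
Proof.
  intros Hf HR Hz0 H0. pose proof (Cmod_pos _ H0) as Hp.
  destruct (disc_bounded f (5 * R1) (entire_cont f Hf)) as [M [HM HfM]].
  set (d := Rmin 1 (Cmod (f z0) / 2)).
  assert (Hd : 0 < d) by (apply Rmin_pos; lra).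
  assert (Hd1 : d <= 1) by apply Rmin_l. assert (Hd2 : d <= Cmod (f z0) / 2) by apply Rmin_r.
  (* With more than [N] zeros, [Cmod (g z0) * 2 ^ length l] would reach [M + 2], but [g] is bounded
     by [M + 1] on the larger disc. *)
  destruct (Pow_x_infinity 2 ltac:(rewrite Rabs_pos_eq; lra) ((M + 2) / (Cmod (f z0) / 2))) as [N HN].
  exists N, d. split; auto. intros g Hg Hgf l ND Hl.
  apply Nat.nlt_ge. intros Hlt. specialize (HN (length l) ltac:(lia)).
  rewrite Rabs_pos_eq in HN by (apply pow_le; lra).
  assert (B : Cmod (g z0) * 2 ^ length l <= M + 1).
  { apply zero_count_bound with R1; auto. intros z Hz.
    pose proof (Cmod_le_sub (g z) (f z)). specialize (HfM z Hz). specialize (Hgf z Hz). lra. }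
  assert (G : Cmod (f z0) / 2 <= Cmod (g z0)).
  { pose proof (Cmod_le_sub (f z0) (g z0)). rewrite Cmod_minus_sym in H. specialize (Hgf z0 ltac:(lra)). lra. }
  assert (P : 0 < 2 ^ length l) by (apply pow_lt; lra).
  assert (Cmod (f z0) / 2 * 2 ^ length l <= Cmod (g z0) * 2 ^ length l) by (apply Rmult_le_compat_r; lra).
  assert ((M + 2) <= Cmod (f z0) / 2 * 2 ^ length l).
  { apply Rle_trans with (Cmod (f z0) / 2 * ((M + 2) / (Cmod (f z0) / 2))).
    - right. field. lra.
    - apply Rmult_le_compat_l; lra. }
  lra.
Qed.

(* Near a simple zero [w] of [f], the Lipschitz bound for [g - f], which vanishes at [w], excludes other zeros
   of [g]. *)
Lemma simple_zeros_stable (f : C -> C) (R1 : R) : entire f ->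
  (forall z, Cmod z <= R1 -> f z = 0%C -> exists l : C, l <> 0%C /\ has_cderiv f z l) ->
  exists delta, 0 < delta /\ forall g, entire g ->
    (forall z, Cmod z <= R1 + 1 -> Cmod (g z - f z) < delta) ->
    (forall z, Cmod z <= R1 -> f z = 0%C -> g z = 0%C) ->
    forall z, Cmod z <= R1 -> g z = 0%C -> f z = 0%C.
Proof.
  intros Hf Hs.
  destruct (disc_uniform R1 (fun m z => forall g, entire g ->
    (forall z, Cmod z <= R1 + 1 -> Cmod (g z - f z) < m) ->
    (forall z, Cmod z <= R1 -> f z = 0%C -> g z = 0%C) -> g z = 0%C -> f z = 0%C)) as [m [Hm H]].
  - intros m m' z Hm H g Hg H1. apply H; auto. intros y Hy. eapply Rlt_le_trans; [apply H1, Hy|]. lra.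
  - intros w Hw. destruct (classic (f w = 0%C)) as [e|n].
    + destruct (Hs w Hw e) as [l [l0 Hl]]. pose proof (Cmod_pos _ l0) as Lp.
      destruct (eps_of_cderiv _ _ _ Hl (Cmod l / 2)) as [d [Hd Hd1]]; [lra|].
      (* Closeness [Cmod l / 8] gives [g - f] the Lipschitz constant [Cmod l / 4], less than the
         rate [Cmod l / 2] at which [f] grows at least when leaving [w]. *)
      exists (Rmin d (Cmod l / 8)). split. { apply Rmin_pos; lra. }
      pose proof (Rmin_l d (Cmod l / 8)). pose proof (Rmin_r d (Cmod l / 8)).
      intros z Hz Hz1 g Hg Hclose Hz0 Hgz.
      destruct (classic (z = w)) as [->|n]; auto. exfalso.
      specialize (Hd1 z ltac:(lra)). rewrite e in Hd1.
      replace (f z - 0 - l * (z - w))%C with (- (l * (z - w) - f z))%C in Hd1 by ring.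
      rewrite Cmod_opp in Hd1.
      pose proof (Cmod_le_sub (l * (z - w)) (f z)) as T. rewrite Cmod_mult in T.
      assert (L : Cmod ((g z - f z) - (g w - f w)) <= 2 * (Cmod l / 8) * Cmod (z - w)).
      { apply (entire_lipschitz (fun z => g z - f z)%C R1); auto; [|lra|].
        - now apply entire_minus.
        - intros y Hy. specialize (Hclose y Hy). lra. }
      rewrite Hgz, (Hz0 w Hw e), e in L.
      replace (0 - f z - (0 - 0))%C with (- f z)%C in L by ring. rewrite Cmod_opp in L.
      pose proof (Cmod_sub_pos _ _ n).
      assert (0 < Cmod l * Cmod (z - w)) by (apply Rmult_lt_0_compat; auto). lra.
    + pose proof (Cmod_pos _ n) as Lp.
      destruct (entire_cont f Hf w (Cmod (f w) / 2)) as [d [Hd Hd1]]; [lra|].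
      exists (Rmin d (Cmod (f w) / 2)). split. { apply Rmin_pos; lra. }
      pose proof (Rmin_l d (Cmod (f w) / 2)). pose proof (Rmin_r d (Cmod (f w) / 2)).
      intros z Hz Hz1 g Hg Hclose _ Hgz. exfalso.
      specialize (Hd1 z ltac:(lra)). specialize (Hclose z ltac:(lra)).
      rewrite Hgz in Hclose. replace (0 - f z)%C with (- f z)%C in Hclose by ring. rewrite Cmod_opp in Hclose.
      pose proof (Cmod_le_sub (f w) (f z)). rewrite Cmod_minus_sym in H1. lra.
  - exists m. split; auto. intros g Hg H1 H2 z Hz. now apply H.
Qed.
(** * Polynomial interpolation *)

(** For fixed [D], a small [s] makes the polynomial small on a given disc and in a given seminorm.
    Coefficients beyond [D] are 0 so that the degree bound may be raised. *)
Definition bounded_poly (D : nat) (s : R) (q : C -> C) : Prop :=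
  exists a : nat -> C, (forall k, Cmod (a k) <= s) /\ (forall k, (D < k)%nat -> a k = 0%C) /\
    forall z, q z = csum (fun k => a k * Cpow z k)%C D.

Lemma csum_ext (a b : nat -> C) n : (forall k, (k <= n)%nat -> a k = b k) -> csum a n = csum b n.
Proof.
  induction n as [|n IH]; intros H; simpl; [auto|]. rewrite IH, H; auto.
Qed.

Lemma csum_plus (a b : nat -> C) n : csum (fun k => a k + b k)%C n = (csum a n + csum b n)%C.
Proof. induction n as [|n IH]; simpl; [auto|]. rewrite IH. ring. Qed.

Lemma csum_scal (c : C) (a : nat -> C) n : csum (fun k => c * a k)%C n = (c * csum a n)%C.
Proof. induction n as [|n IH]; simpl; [auto|]. rewrite IH. ring. Qed.

Lemma csum_trailing_zeros (a : nat -> C) n m : (forall k, (n < k)%nat -> a k = 0%C) -> (n <= m)%nat -> csum a m = csum a n.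
Proof.
  intros H. induction 1 as [|m Hm IH]; simpl; [auto|]. rewrite IH, H by lia. ring.
Qed.

Lemma bounded_poly_mono D D' s s' q : (D <= D')%nat -> s <= s' -> bounded_poly D s q -> bounded_poly D' s' q.
Proof.
  intros HD Hs [a [A1 [A2 A3]]]. exists a. split; [|split].
  - intros k. eapply Rle_trans; eauto.
  - intros k Hk. apply A2. lia.
  - intros z. rewrite A3. symmetry. apply csum_trailing_zeros; auto.
    intros k Hk. rewrite A2 by auto. ring.
Qed.

Lemma bounded_poly_const c : bounded_poly 0 (Cmod c) (fun _ => c).
Proof.
  exists (fun k => match k with O => c | _ => RtoC 0 end). split; [|split].
  - intros [|k]; [lra|]. rewrite Cmod_0. apply Cmod_ge_0.
  - intros [|k] Hk; [lia|auto].
  - intros z; simpl. ring.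
Qed.

Lemma bounded_poly_zero D s : 0 <= s -> bounded_poly D s (fun _ => RtoC 0).
Proof.
  intros Hs. apply bounded_poly_mono with O (Cmod 0%C); [lia|rewrite Cmod_0; auto|].
  apply bounded_poly_const.
Qed.

Lemma bounded_poly_plus D s t f g : bounded_poly D s f -> bounded_poly D t g ->
  bounded_poly D (s + t) (fun z => f z + g z)%C.
Proof.
  intros [a [A1 [A2 A3]]] [b [B1 [B2 B3]]]. exists (fun k => a k + b k)%C. split; [|split].
  - intros k. eapply Rle_trans; [apply Cmod_triangle|]. apply Rplus_le_compat; auto.
  - intros k Hk. rewrite A2, B2 by auto. ring.
  - intros z. rewrite A3, B3, <- csum_plus. apply csum_ext. intros; ring.
Qed.

Lemma bounded_poly_mul_linear D s W w f : bounded_poly D s f -> Cmod w <= W ->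
  bounded_poly (S D) (s * (1 + W)) (fun z => (z - w) * f z)%C.
Proof.
  intros [a [A1 [A2 A3]]] Hw.
  assert (Hs : 0 <= s) by (eapply Rle_trans; [apply Cmod_ge_0|apply (A1 O)]).
  pose (sh := fun k => match k with O => RtoC 0 | S k' => a k' end).
  exists (fun k => sh k - w * a k)%C. split; [|split].
  - intros k. eapply Rle_trans; [apply Cmod_minus_le|]. rewrite Cmod_mult.
    assert (Cmod w * Cmod (a k) <= W * s) by (apply Rmult_le_compat; auto using Cmod_ge_0).
    assert (Cmod (sh k) <= s). { destruct k; simpl; auto. rewrite Cmod_0. auto. } lra.
  - intros k Hk. rewrite (A2 k) by lia. destruct k; [lia|]. simpl. rewrite A2 by lia. ring.
  - intros z.
    assert (E : forall n, csum (fun k => sh k * Cpow z k)%C (S n) = (z * csum (fun k => a k * Cpow z k) n)%C).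
    { induction n as [|n IH]; [simpl; ring|].
      change (csum (fun k => sh k * Cpow z k)%C (S (S n))) with
        (csum (fun k => sh k * Cpow z k)%C (S n) + sh (S (S n)) * Cpow z (S (S n)))%C.
      rewrite IH. simpl. ring. }
    transitivity (csum (fun k => sh k * Cpow z k)%C (S D) + (- w) * csum (fun k => a k * Cpow z k)%C (S D))%C.
    + rewrite E, (csum_trailing_zeros _ D (S D)); [|intros k Hk; rewrite A2 by auto; ring|lia].
      rewrite A3. ring.
    + rewrite <- csum_scal, <- csum_plus. apply csum_ext. intros; ring.
Qed.

Lemma bounded_poly_mul_roots D s W l f : 0 <= W -> bounded_poly D s f -> (forall w, In w l -> Cmod w <= W) ->
  bounded_poly (length l + D) (s * (1 + W) ^ length l) (fun z => root_prod l z * f z)%C.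
Proof.
  intros HW Hf. induction l as [|a l IH]; intros Hl; simpl.
  - destruct Hf as [c [A1 [A2 A3]]]. exists c. rewrite Rmult_1_r. split; [auto|split; auto].
    intros z. rewrite A3. ring.
  - destruct (bounded_poly_mul_linear (length l + D) (s * (1 + W) ^ length l) W a
      (fun z => root_prod l z * f z)%C) as [c [A1 [A2 A3]]].
    { apply IH. intros w Hw. apply Hl. now right. } { apply Hl. now left. }
    exists c. split; [|split; auto].
    + intros k. eapply Rle_trans; [apply A1|]. right. ring.
    + intros z. rewrite <- A3. ring.
Qed.

Lemma is_poly_of_bounded D s q : bounded_poly D s q -> is_poly_map q.
Proof. intros [a [_ [_ H]]]. now exists a, D. Qed.

Lemma entire_pow k : entire (fun z => Cpow z k).
Proof.
  induction k as [|k IH]; simpl; [apply entire_const|]. apply entire_mult; auto using entire_id.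
Qed.

Lemma entire_ext f g : (forall z, f z = g z) -> entire f -> entire g.
Proof. intros H Hf z. destruct (Hf z) as [l Hl]. exists l. now apply cderiv_ext with f. Qed.

Lemma entire_bounded_poly D s q : bounded_poly D s q -> entire q.
Proof.
  intros [a [_ [_ H]]]. apply entire_ext with (fun z => csum (fun k => a k * Cpow z k)%C D); auto.
  clear H. induction D as [|D IH]; simpl.
  - apply entire_mult; [apply entire_const|apply entire_pow with (k := O)].
  - apply entire_plus; auto. apply entire_mult; [apply entire_const|apply (entire_pow (S D))].
Qed.

Lemma bounded_poly_sup D s q rho : bounded_poly D s q -> 0 <= rho ->
  forall z, Cmod z <= rho -> Cmod (q z) <= s * sum_f_R0 (pow rho) D.
Proof.
  intros [a [A1 [_ H]]] Hr z Hz. rewrite H. clear H.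
  assert (Ht : forall k, Cmod (a k * Cpow z k)%C <= s * rho ^ k).
  { intros k. rewrite Cmod_mult, Cmod_pow. apply Rmult_le_compat; auto using Cmod_ge_0.
    - apply pow_le, Cmod_ge_0.
    - apply pow_incr. split; auto using Cmod_ge_0. }
  induction D as [|D IH]; [apply (Ht O)|].
  simpl. eapply Rle_trans; [apply Cmod_triangle|]. specialize (Ht (S D)). simpl in Ht. lra.
Qed.

Lemma entire_root_prod l : entire (root_prod l).
Proof.
  induction l as [|a l IH]; [apply entire_const|].
  apply (entire_mult (fun z => z - a)%C (root_prod l)); auto.
  apply entire_minus; auto using entire_id, entire_const.
Qed.

Lemma root_prod_root l w : In w l -> root_prod l w = 0%C.
Proof.
  induction l as [|a l IH]; [intros []|]. intros [->|H]; simpl; [ring|]. rewrite IH by auto. ring.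
Qed.

(** The node polynomial enters squared, so that adding this function, for entire [q], changes
    neither values nor derivatives at the nodes. *)
Definition double_root_prod (l : list C) (q : C -> C) (z : C) : C := (root_prod l z * (root_prod l z * q z))%C.

Lemma double_root_prod_root l q w : entire q -> In w l ->
  double_root_prod l q w = 0%C /\ has_cderiv (double_root_prod l q) w 0%C.
Proof.
  intros Hq Hw. pose proof (root_prod_root l w Hw) as E. split.
  - unfold double_root_prod. rewrite E. ring.
  - destruct (entire_root_prod l w) as [a Ha]. destruct (Hq w) as [b Hb].
    eapply cderiv_eq.
    + apply cderiv_mult; [exact Ha|]. apply cderiv_mult; [exact Ha|exact Hb].
    + cbv beta. rewrite !E. ring.
Qed.

Lemma list_bounded (l : list C) : exists W, 0 <= W /\ forall a, In a l -> Cmod a <= W.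
Proof.
  induction l as [|b l [W [HW IH]]].
  - exists 0. split; [lra|]. intros a [].
  - exists (W + Cmod b). pose proof (Cmod_ge_0 b). split; [lra|].
    intros a [->|H']; [lra|]. specialize (IH a H'). lra.
Qed.

(* Newton's scheme for Hermite interpolation, with bounds uniform in the (moving) nodes [om z]. *)
Lemma hermite_interpolation (h : C -> C) (A L : list C) : entire h -> NoDup L ->
  (forall z, In z L -> ~ In z A) -> forall s, 0 < s -> exists eta, 0 < eta /\ forall om v d : C -> C,
  (forall z, In z L -> Cmod (om z - z) < eta /\ Cmod (v z - h z) < eta /\
     exists l, has_cderiv h (om z) l /\ Cmod (d z - l) < eta) ->
  exists q, bounded_poly (2 * (length A + length L)) s q /\
    (forall a, In a A -> q a = 0%C /\ has_cderiv q a 0%C) /\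
    forall z, In z L -> (h (om z) + q (om z))%C = v z /\ has_cderiv (fun y => h y + q y)%C (om z) (d z).
Proof.
  intros Hh. induction L as [|z0 L IH]; intros ND Hdis s Hs.
  - exists 1. split; [lra|]. intros om v d _. exists (fun _ => RtoC 0). split; [|split].
    + apply bounded_poly_zero. lra.
    + intros a _. split; auto. apply cderiv_const.
    + intros z [].
  - inversion ND as [|? ? Hz0 ND']; subst.
    destruct (list_bounded (A ++ z0 :: L)) as [W0 [HW0 HW]].
    set (W := W0 + 1). assert (HW1 : 1 <= W) by (unfold W; lra).
    (* [r] separates [z0] from the other nodes; displacements below [r / 4] leave a gap of
       [ka = r / 2]. Then [b0] and [CB] bound the squared node polynomial from below at the moved
       [z0] and from above on a disc, wherever the nodes have moved. *)
    destruct (list_separated (A ++ L) z0) as [r [Hr Hsep]].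
    set (n := (length A + length L)%nat).
    set (ka := r / 2). assert (Hka : 0 < ka) by (unfold ka; lra).
    set (b0 := ka ^ n * ka ^ n).
    assert (Hb0 : 0 < b0) by (apply Rmult_lt_0_compat; apply pow_lt; auto).
    set (CB := (2 * W + 1) ^ n * (2 * W + 1) ^ n).
    assert (HCB : 0 < CB) by (apply Rmult_lt_0_compat; apply pow_lt; lra).
    set (C2 := sum_f_R0 (pow (W + 1)) (2 * n)).
    assert (HC2 : 0 <= C2) by (apply cond_pos_sum; intros; apply pow_le; lra).
    set (PW := (1 + W) ^ n * (1 + W) ^ n).
    assert (HPW : 0 < PW) by (apply Rmult_lt_0_compat; apply pow_lt; lra).
    (* At error scale [tau] the Newton coefficients [al] and [be] below are at most [ca * tau] and
       [cb * tau]: each numerator contributes [3 * tau], the second also the product [lB * al].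
       [K * tau] bounds the coefficients of the correction and is to use up half of [s]. *)
    set (ca := 3 / b0). assert (Hca : 0 < ca) by (apply Rdiv_lt_0_compat; lra).
    set (cb := (3 + 2 * CB * ca) / b0).
    assert (HCc : 0 < CB * ca) by (apply Rmult_lt_0_compat; auto).
    assert (Hcb : 0 < cb) by (apply Rdiv_lt_0_compat; lra).
    set (K := (ca + cb * (1 + W)) * PW).
    assert (HK : 0 < K). { apply Rmult_lt_0_compat; auto. assert (0 < cb * (1 + W)) by (apply Rmult_lt_0_compat; lra). lra. }
    set (tau := s / (2 * K)). assert (Htau : 0 < tau) by (apply Rdiv_lt_0_compat; lra).
    assert (HtK : tau * K = s / 2) by (unfold tau; field; lra).
    (* The other half of [s] goes to the remaining nodes, reduced further so that [q'] is at most
       [tau] on the disc of radius [W + 1]. *)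
    set (s' := Rmin (s / 2) (tau / (C2 + 1))).
    assert (Hs' : 0 < s') by (apply Rmin_pos; [lra|apply Rdiv_lt_0_compat; lra]).
    assert (Hs'1 : s' <= s / 2) by apply Rmin_l.
    assert (Hs'2 : s' * C2 <= tau).
    { apply Rle_trans with (tau / (C2 + 1) * (C2 + 1)); [|right; field; lra].
      apply Rmult_le_compat; try lra. apply Rmin_r. }
    destruct (IH ND' ltac:(intros z Hz; apply Hdis; now right) s' Hs') as [eta' [He' IHq]].
    destruct (entire_cont h Hh z0 tau Htau) as [dc [Hdc Hcont]].
    set (eta := Rmin (Rmin 1 (r / 4)) (Rmin (Rmin tau dc) eta')).
    assert (Heta : 0 < eta) by (unfold eta; repeat apply Rmin_pos; lra).
    assert (E1 : eta <= Rmin 1 (r / 4)) by apply Rmin_l.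
    assert (E2 : eta <= Rmin (Rmin tau dc) eta') by apply Rmin_r.
    assert (Eta : eta <= 1 /\ eta <= r / 4 /\ eta <= tau /\ eta <= dc /\ eta <= eta').
    { pose proof (Rmin_l 1 (r / 4)). pose proof (Rmin_r 1 (r / 4)). pose proof (Rmin_l (Rmin tau dc) eta').
      pose proof (Rmin_r (Rmin tau dc) eta'). pose proof (Rmin_l tau dc). pose proof (Rmin_r tau dc). lra. }
    clear E1 E2. exists eta. split; auto. intros om v d Hclose.
    destruct (IHq om v d) as [q' [Q1 [Q2 Q3]]].
    { intros z Hz. destruct (Hclose z (or_intror Hz)) as [H1 [H2 [l [H3 H4]]]].
      split; [lra|split; [lra|]]. exists l. split; auto. lra. }
    destruct (Hclose z0 (or_introl eq_refl)) as [Hw [Hv [lh [Hlh Hd]]]].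
    set (w := om z0) in *. set (l := A ++ map om L).
    assert (Hlen : length l = n) by (unfold l, n; rewrite length_app, length_map; auto).
    assert (HwW : Cmod w <= W).
    { pose proof (Cmod_le_sub w z0). pose proof (HW z0 ltac:(apply in_or_app; right; now left)). unfold W. lra. }
    assert (HlW : forall a, In a l -> Cmod a <= W).
    { intros a Ha. apply in_app_or in Ha. destruct Ha as [Ha|Ha].
      - pose proof (HW a ltac:(apply in_or_app; now left)). unfold W; lra.
      - apply in_map_iff in Ha. destruct Ha as [y [<- Hy]].
        pose proof (HW y ltac:(apply in_or_app; right; now right)). pose proof (Cmod_le_sub (om y) y).
        destruct (Hclose y (or_intror Hy)) as [H1 _]. unfold W; lra. }
    assert (Hlw : forall a, In a l -> ka <= Cmod (w - a)).
    { intros a Ha. apply in_app_or in Ha. destruct Ha as [Ha|Ha].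
      - pose proof (Hsep a ltac:(apply in_or_app; now left)
          ltac:(intros ->; apply (Hdis z0); [now left|auto])) as H1.
        pose proof (Cmod_sub_triangle a w z0) as H2. rewrite (Cmod_minus_sym a w) in H2. unfold ka; lra.
      - apply in_map_iff in Ha. destruct Ha as [y [<- Hy]].
        pose proof (Hsep y ltac:(apply in_or_app; now right) ltac:(intros ->; auto)) as H1.
        pose proof (Cmod_sub_triangle y (om y) z0) as H2. pose proof (Cmod_sub_triangle (om y) w z0) as H3.
        rewrite (Cmod_minus_sym (om y) w) in H3. rewrite (Cmod_minus_sym y (om y)) in H2.
        destruct (Hclose y (or_intror Hy)) as [H4 _]. unfold ka; lra. }
    set (Bf := fun x => (root_prod l x * root_prod l x)%C).
    assert (HBw : b0 <= Cmod (Bf w)).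
    { unfold Bf, b0. rewrite Cmod_mult. assert (ka ^ n <= Cmod (root_prod l w)).
      { rewrite <- Hlen. apply root_prod_ge; [lra|auto]. }
      apply Rmult_le_compat; auto; apply pow_le; lra. }
    assert (HB0 : Bf w <> 0%C) by (apply Cmod_pos_neq; lra).
    assert (HBe : entire Bf) by (apply entire_mult; apply entire_root_prod).
    destruct (HBe w) as [lB HlB]. destruct (entire_bounded_poly _ _ _ Q1 w) as [lq Hlq].
    assert (HlBb : Cmod lB <= 2 * CB).
    { apply cderiv_bound with Bf w W; auto. intros z Hz. unfold Bf, CB. rewrite Cmod_mult.
      assert (Cmod (root_prod l z) <= (2 * W + 1) ^ n).
      { rewrite <- Hlen. apply root_prod_le. intros a Ha. pose proof (Cmod_minus_le z a). specialize (HlW a Ha). lra. }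
      apply Rmult_le_compat; auto using Cmod_ge_0. }
    assert (Hq' : forall z, Cmod z <= W + 1 -> Cmod (q' z) <= tau).
    { intros z Hz. eapply Rle_trans; [|exact Hs'2]. apply bounded_poly_sup with (rho := W + 1); auto. lra. }
    assert (Hlqb : Cmod lq <= 2 * tau).
    { apply cderiv_bound with q' w W; auto. now apply entire_bounded_poly with (1 := Q1). }
    (* [al] corrects the value at [w] and [be] the derivative; the factor [Bf] protects the other
       nodes. *)
    set (al := ((v z0 - h w - q' w) / Bf w)%C).
    assert (Hdiv : forall x t, Cmod x <= t -> 0 <= t -> Cmod (x / Bf w)%C <= t / b0).
    { intros x t Hx Ht. rewrite Cmod_div by auto. apply Rmult_le_compat; auto using Cmod_ge_0.
      - left. apply Rinv_0_lt_compat. now apply Cmod_pos.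
      - apply Rinv_le_contravar; auto. }
    assert (Hal : Cmod al <= ca * tau).
    { replace (ca * tau) with (3 * tau / b0) by (unfold ca; field; lra). apply Hdiv; [|lra].
      replace (v z0 - h w - q' w)%C with ((v z0 - h z0) - (h w - h z0) - q' w)%C by ring.
      eapply Rle_trans; [apply Cmod_minus_le|]. eapply Rle_trans; [apply Rplus_le_compat_r, Cmod_minus_le|].
      specialize (Hcont w ltac:(lra)). specialize (Hq' w ltac:(lra)). lra. }
    set (be := ((d z0 - lh - lq - lB * al) / Bf w)%C).
    assert (Hbe : Cmod be <= cb * tau).
    { replace (cb * tau) with ((3 * tau + 2 * CB * (ca * tau)) / b0) by (unfold cb; field; lra).
      assert (T : Cmod lB * Cmod al <= 2 * CB * (ca * tau)) by (apply Rmult_le_compat; auto using Cmod_ge_0).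
      assert (0 <= Cmod lB * Cmod al) by (apply Rmult_le_pos; apply Cmod_ge_0).
      apply Hdiv; [|lra].
      eapply Rle_trans; [apply Cmod_minus_le|]. rewrite Cmod_mult.
      eapply Rle_trans; [apply Rplus_le_compat_r, Cmod_minus_le|]. lra. }
    set (lin := fun x : C => ((x - w) * be + al)%C).
    assert (Hlin : bounded_poly 1 ((ca + cb * (1 + W)) * tau) lin).
    { apply bounded_poly_mono with 1%nat (Cmod be * (1 + W) + Cmod al); [lia| |].
      - assert (Cmod be * (1 + W) <= cb * tau * (1 + W)) by (apply Rmult_le_compat_r; lra). lra.
      - apply bounded_poly_plus.
        + apply bounded_poly_mul_linear; auto. apply bounded_poly_const.
        + apply bounded_poly_mono with O (Cmod al); [lia|lra|apply bounded_poly_const]. }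
    assert (Hline : entire lin) by (apply entire_bounded_poly with (1 := Hlin)).
    exists (fun x => q' x + double_root_prod l lin x)%C.
    assert (HBd : has_cderiv (double_root_prod l lin) w (lB * al + Bf w * be)%C).
    { apply cderiv_ext with (fun x => Bf x * lin x)%C.
      { intros y. unfold Bf, double_root_prod. ring. }
      eapply cderiv_eq.
      - apply cderiv_mult; [exact HlB|]. apply cderiv_plus; [|apply cderiv_const].
        apply cderiv_mult; [|apply cderiv_const]. apply cderiv_minus; [apply cderiv_id|apply cderiv_const].
      - unfold lin. ring. }
    split; [|split].
    + apply bounded_poly_mono with (2 * n + 1)%nat (s' + s / 2); [unfold n; simpl length; lia|lra|].
      apply bounded_poly_plus.
      * apply bounded_poly_mono with (3 := Q1); [unfold n; lia|lra].
      * apply bounded_poly_mono with (n + (n + 1))%nat ((ca + cb * (1 + W)) * tau * (1 + W) ^ n * (1 + W) ^ n); [lia| |].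
        -- right. transitivity (tau * K); [unfold K, PW; ring|exact HtK].
        -- rewrite <- Hlen. apply bounded_poly_mul_roots; [lra| |auto]. apply bounded_poly_mul_roots; [lra| |auto]. auto.
    + intros a Ha. destruct (Q2 a Ha) as [Qa Qd].
      destruct (double_root_prod_root l lin a Hline ltac:(apply in_or_app; now left)) as [Ba Bd].
      split.
      * rewrite Qa, Ba. ring.
      * eapply cderiv_eq; [apply cderiv_plus; [exact Qd|exact Bd]|ring].
    + intros z [<-|Hz].
      * fold w. split.
        -- unfold double_root_prod, lin, al, Bf. field. intros E0. apply HB0. unfold Bf. rewrite E0. ring.
        -- eapply cderiv_eq.
           ++ apply cderiv_plus; [exact Hlh|]. apply cderiv_plus; [exact Hlq|exact HBd].
           ++ unfold be. field. auto.
      * destruct (Q3 z Hz) as [Qv Qd].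
        destruct (double_root_prod_root l lin (om z) Hline ltac:(apply in_or_app; right; now apply in_map)) as [Ba Bd].
        split.
        -- rewrite <- Qv, Ba. ring.
        -- eapply cderiv_eq.
           ++ apply cderiv_ext with (fun y => (h y + q' y) + double_root_prod l lin y)%C; [intros; ring|].
              apply cderiv_plus; [exact Qd|exact Bd].
           ++ ring.
Qed.
(** * Iterates and cycles *)

Lemma iterate_add f m n z : iterate f (m + n) z = iterate f m (iterate f n z).
Proof. apply Nat.iter_add. Qed.

Lemma iterate_mul_period f m q z : iterate f m z = z -> iterate f (m * q) z = z.
Proof.
  intros H. induction q as [|q IH].
  - now rewrite Nat.mul_0_r.
  - rewrite Nat.mul_succ_r, iterate_add, H. exact IH.
Qed.

Lemma entire_iterate f n : entire f -> entire (iterate f n).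
Proof.
  intros Hf. induction n as [|n IH]; [apply entire_id|]. exact (entire_comp _ _ IH Hf).
Qed.

(** In the induction step [g x - f y] is split as [(g x - f x) + (f x - f y)] with [x], [y] the
    earlier iterates. The first term needs closeness on a disc containing these iterates, whence the
    new radius [rho']; the second is a Lipschitz estimate for [f]. *)
Lemma iterate_close (f : C -> C) (n : nat) (rho delta : R) : entire f -> 0 < delta ->
  exists rho' delta', 0 < rho' /\ 0 < delta' /\ forall g,
    (forall z, Cmod z <= rho' -> Cmod (g z - f z) < delta') ->
    forall z, Cmod z <= rho -> Cmod (iterate g n z - iterate f n z) < delta.
Proof.
  intros Hf. revert delta. induction n as [|n IH]; intros delta Hd.
  - exists 1, 1. split; [lra|split; [lra|]]. intros g _ z _. simpl. rewrite Cmod_sub_diag. auto.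
  - destruct (disc_bounded (iterate f n) rho (entire_cont _ (entire_iterate f n Hf))) as [M [HM HM1]].
    destruct (disc_bounded f (M + 1) (entire_cont _ Hf)) as [M' [HM' HM1']].
    set (d := Rmin 1 (delta / (4 * M'))).
    assert (Hd0 : 0 < d) by (apply Rmin_pos; [lra|apply Rdiv_lt_0_compat; lra]).
    assert (Hd1 : d <= 1) by apply Rmin_l.
    assert (Hd2 : 2 * M' * d <= delta / 2).
    { apply Rle_trans with (2 * M' * (delta / (4 * M'))).
      - apply Rmult_le_compat_l; [lra|apply Rmin_r].
      - right. field. lra. }
    destruct (IH d Hd0) as [r1 [d1 [Hr1 [Hd1' H1]]]].
    exists (Rmax r1 (M + 1)), (Rmin d1 (delta / 2)).
    pose proof (Rmax_l r1 (M + 1)). pose proof (Rmax_r r1 (M + 1)).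
    pose proof (Rmin_l d1 (delta / 2)). pose proof (Rmin_r d1 (delta / 2)).
    split; [lra|]. split; [apply Rmin_pos; lra|].
    intros g Hg z Hz.
    assert (A : Cmod (iterate g n z - iterate f n z) < d).
    { apply H1; auto. intros y Hy. specialize (Hg y ltac:(lra)). lra. }
    pose proof (HM1 z Hz) as B. pose proof (Cmod_le_sub (iterate g n z) (iterate f n z)) as B'.
    set (x := iterate g n z) in *. set (y := iterate f n z) in *.
    change (Cmod (g x - f y) < delta).
    pose proof (Cmod_sub_triangle (g x) (f x) (f y)) as T.
    pose proof (Hg x ltac:(lra)) as T1.
    assert (T2 : Cmod (f x - f y) <= 2 * M' * Cmod (x - y)).
    { apply entire_lipschitz with M; auto. lra. }
    assert (2 * M' * Cmod (x - y) <= 2 * M' * d) by (apply Rmult_le_compat_l; lra).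
    lra.
Qed.

Lemma exists_exact_period f x n : (1 <= n)%nat -> iterate f n x = x -> exists m, exact_period f x m.
Proof.
  induction n as [n IH] using (well_founded_induction Nat.lt_wf_0). intros Hn Hx.
  destruct (classic (exists m, (1 <= m)%nat /\ (m < n)%nat /\ iterate f m x = x)) as [[m [M1 [M2 M3]]]|N].
  - now apply (IH m).
  - exists n. split; auto. split; auto. intros m M1 M2 M3. apply N. eauto.
Qed.

Lemma exact_period_divides f x m n : exact_period f x m -> iterate f n x = x -> exists q, n = (m * q)%nat.
Proof.
  intros [P1 [P2 P3]] Hn. exists (n / m)%nat.
  assert (E : n = (n mod m + m * (n / m))%nat) by (rewrite Nat.add_comm; apply Nat.div_mod; lia).
  assert (Hr : iterate f (n mod m) x = x).
  { rewrite E, iterate_add, (iterate_mul_period f m) in Hn; auto. }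
  pose proof (Nat.mod_upper_bound n m ltac:(lia)) as Hlt.
  destruct (Nat.eq_dec (n mod m) 0) as [Z|Z]; [lia|].
  exfalso. apply (P3 (n mod m)%nat); auto. lia.
Qed.

Lemma iterate_comm f m n x : iterate f m (iterate f n x) = iterate f n (iterate f m x).
Proof. rewrite <- !iterate_add. f_equal. lia. Qed.

(** The point is recovered from its [i]-th iterate by completing [i] full turns. No truncation
    occurs in the subtraction as [1 <= m], and [i] may exceed [m]. *)
Lemma iterate_return f x m i : (1 <= m)%nat -> iterate f m x = x -> iterate f (m * i - i) (iterate f i x) = x.
Proof.
  intros Hm Hx. rewrite <- iterate_add. replace (m * i - i + i)%nat with (m * i)%nat by nia.
  now apply iterate_mul_period.
Qed.

Lemma exact_period_iterate f x m i : exact_period f x m -> exact_period f (iterate f i x) m.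
Proof.
  intros [P1 [P2 P3]]. split; auto. split.
  - now rewrite iterate_comm, P2.
  - intros k K1 K2 K3. apply (P3 k K1 K2).
    rewrite <- (iterate_return f x m i P1 P2) at 1. now rewrite iterate_comm, K3, iterate_return.
Qed.

(** * Cycles as lists, and products of derivatives along them *)

Definition orbit_list (f : C -> C) (x : C) (m : nat) : list C := map (fun i => iterate f i x) (seq 0 m).

Lemma orbit_list_complete f x m k : exact_period f x m -> In (iterate f k x) (orbit_list f x m).
Proof.
  intros [P1 [P2 P3]]. apply in_map_iff. exists (k mod m)%nat.
  pose proof (Nat.mod_upper_bound k m ltac:(lia)). split; [|apply in_seq; lia].
  assert (E : k = (k mod m + m * (k / m))%nat) by (rewrite Nat.add_comm; apply Nat.div_mod; lia).
  rewrite E at 2. rewrite iterate_add, (iterate_mul_period f m); auto.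
Qed.

Lemma orbit_list_elim f x m y : In y (orbit_list f x m) -> exists k, y = iterate f k x.
Proof. intros H. apply in_map_iff in H. destruct H as [k [<- _]]. eauto. Qed.

Lemma orbit_list_NoDup f x m : exact_period f x m -> NoDup (orbit_list f x m).
Proof.
  intros [P1 [P2 P3]].
  assert (H : forall i j, (i < j)%nat -> (j < m)%nat -> iterate f i x <> iterate f j x).
  { intros i j Hij Hj E. apply (P3 (m - j + i)%nat); [lia|lia|].
    rewrite iterate_add, E, <- iterate_add. replace (m - j + j)%nat with m by lia. auto. }
  apply NoDup_map_NoDup_ForallPairs; [|apply seq_NoDup].
  intros i j Hi Hj E. apply in_seq in Hi. apply in_seq in Hj.
  destruct (Nat.lt_trichotomy i j) as [h|[h|h]]; auto; exfalso.
  - apply (H i j); auto. lia.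
  - apply (H j i); auto. lia.
Qed.

(** The chain rule product for the [k]-th iterate, with prescribed factors [d]: the orbit is that of
    the old map, the derivatives are those of the map to be constructed. *)
Fixpoint orbit_prod (f d : C -> C) (k : nat) (x : C) : C :=
  match k with O => RtoC 1 | S j => (d (iterate f j x) * orbit_prod f d j x)%C end.

Lemma orbit_prod_add (f d : C -> C) a b x : orbit_prod f d (a + b) x = (orbit_prod f d a (iterate f b x) * orbit_prod f d b x)%C.
Proof.
  induction a as [|a IH]; simpl; [ring|]. rewrite IH, iterate_add. ring.
Qed.

Lemma orbit_prod_pow (f d : C -> C) m q x : iterate f m x = x -> orbit_prod f d (m * q) x = Cpow (orbit_prod f d m x) q.
Proof.
  intros Hx. induction q as [|q IH].
  - now rewrite Nat.mul_0_r.
  - rewrite Nat.mul_succ_r, orbit_prod_add, Hx, IH. simpl. ring.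
Qed.

Lemma orbit_prod_shift (f d : C -> C) m x : iterate f m x = x -> d x <> 0%C -> orbit_prod f d m (f x) = orbit_prod f d m x.
Proof.
  intros Hx Hd.
  assert (E : (orbit_prod f d m (f x) * d x = d x * orbit_prod f d m x)%C).
  { transitivity (orbit_prod f d (m + 1) x).
    - rewrite orbit_prod_add. simpl. ring.
    - rewrite Nat.add_comm, orbit_prod_add, Hx. simpl. ring. }
  replace (orbit_prod f d m (f x)) with (orbit_prod f d m (f x) * d x / d x)%C by (field; exact Hd).
  rewrite E. field. exact Hd.
Qed.

Lemma orbit_prod_iterate (f d : C -> C) m x i : iterate f m x = x -> (forall k, d (iterate f k x) <> 0%C) ->
  orbit_prod f d m (iterate f i x) = orbit_prod f d m x.
Proof.
  intros Hx Hd. induction i as [|i IH]; auto.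
  change (iterate f (S i) x) with (f (iterate f i x)). rewrite orbit_prod_shift; auto.
  now rewrite iterate_comm, Hx.
Qed.

Lemma orbit_prod_neq_0 (f d : C -> C) k x : (forall j, (j < k)%nat -> d (iterate f j x) <> 0%C) -> orbit_prod f d k x <> 0%C.
Proof.
  induction k as [|k IH]; intros H; simpl; [apply C1_nz|]. apply Cmult_neq_0; auto.
Qed.

(** [om] carries the [f]-orbit of [x] to a [g]-orbit with derivatives [d], so the multiplier of a
    moved cycle can be read off along the old one. *)
Lemma semiconj_iterate (f g om d : C -> C) (x : C) :
  (forall k, g (om (iterate f k x)) = om (iterate f (S k) x) /\ has_cderiv g (om (iterate f k x)) (d (iterate f k x))) ->
  forall n, iterate g n (om x) = om (iterate f n x) /\ has_cderiv (iterate g n) (om x) (orbit_prod f d n x).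
Proof.
  intros H n. induction n as [|n [IH1 IH2]].
  - split; auto. apply cderiv_id.
  - destruct (H n) as [V D]. split.
    + simpl. change (g (iterate g n (om x)) = om (iterate f (S n) x)). now rewrite IH1.
    + apply (cderiv_comp _ _ _ _ _ IH2). now rewrite IH1.
Qed.

(** The implication between derivatives amounts to equality when [f] is entire, since derivatives
    are unique; hence [agree_sym]. *)
Definition agree (A : list C) (f g : C -> C) : Prop :=
  forall a, In a A -> g a = f a /\ forall l, has_cderiv f a l -> has_cderiv g a l.

Lemma agree_refl A f : agree A f f.
Proof. intros a _. auto. Qed.

Lemma agree_trans A A' f g k : incl A A' -> agree A f g -> agree A' g k -> agree A f k.
Proof.
  intros Hi H1 H2 a Ha. destruct (H1 a Ha) as [V1 D1], (H2 a (Hi a Ha)) as [V2 D2].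
  split; [congruence|auto].
Qed.

Lemma agree_sym A f g : entire f -> agree A f g -> agree A g f.
Proof.
  intros Hf H a Ha. destruct (H a Ha) as [V D]. split; auto.
  intros l Hl. destruct (Hf a) as [l' Hl']. now rewrite (cderiv_unique _ _ _ _ Hl (D _ Hl')).
Qed.

(** All values and derivatives along the orbit are then frozen, hence all iterates at [a] and their
    derivatives. *)
Definition orbit_in (A : list C) (f : C -> C) (a : C) : Prop := forall k, In (iterate f k a) A.

Lemma agree_orbit A f g a : entire f -> agree A f g -> orbit_in A f a ->
  forall k, iterate g k a = iterate f k a /\
    exists l, has_cderiv (iterate f k) a l /\ has_cderiv (iterate g k) a l.
Proof.
  intros Hf H Ho k. induction k as [|k [IH1 [l [IH2 IH3]]]].
  - split; auto. exists 1%C. split; apply cderiv_id.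
  - destruct (H _ (Ho k)) as [V D]. split.
    + simpl. now rewrite IH1.
    + destruct (Hf (iterate f k a)) as [b Hb]. exists (b * l)%C. split.
      * exact (cderiv_comp _ _ _ _ _ IH2 Hb).
      * apply (cderiv_comp _ _ _ _ _ IH3). rewrite IH1. auto.
Qed.

Lemma agree_orbit_in A f g a : entire f -> agree A f g -> orbit_in A f a -> orbit_in A g a.
Proof. intros Hf H Ho k. destruct (agree_orbit A f g a Hf H Ho k) as [-> _]. apply Ho. Qed.

(** * Separation in finite sets and choices from dense sets *)

Lemma list_pairwise_separated (S : list C) :
  exists r, 0 < r /\ forall s t, In s S -> In t S -> s <> t -> r <= Cmod (s - t).
Proof.
  induction S as [|a S [r [Hr IH]]].
  - exists 1. split; [lra|]. intros s t [].
  - destruct (list_separated S a) as [r' [Hr' H]].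
    exists (Rmin r r'). split; [now apply Rmin_pos|].
    pose proof (Rmin_l r r'). pose proof (Rmin_r r r').
    intros s t [->|Hs] [->|Ht] n.
    + now destruct n.
    + specialize (H t Ht ltac:(auto)). rewrite Cmod_minus_sym. lra.
    + specialize (H s Hs n). lra.
    + specialize (IH s t Hs Ht n). lra.
Qed.

Lemma dense_avoiding_list (D : C -> Prop) (l : list C) (z : C) (eps : R) : dense_set D -> 0 < eps ->
  exists w, D w /\ Cmod (w - z) < eps /\ ~ In w l.
Proof.
  intros HD He. destruct (list_separated l z) as [r [Hr H]].
  (* Aiming at [z + t] puts [w] at a distance between [t / 2] and [3 * t / 2] from [z]: too close
     for any other listed point, and different from [z], which may be listed itself. *)
  set (t := Rmin eps r / 2).
  assert (Ht : 0 < Rmin eps r) by (apply Rmin_pos; auto).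
  pose proof (Rmin_l eps r). pose proof (Rmin_r eps r).
  destruct (HD (z + RtoC t)%C (t / 2)) as [w [Hw Hwt]]; [unfold t; lra|].
  assert (Hm : Cmod (z + RtoC t - z) = t).
  { replace (z + RtoC t - z)%C with (RtoC t) by ring. rewrite Cmod_R. apply Rabs_pos_eq. unfold t; lra. }
  pose proof (Cmod_sub_triangle w (z + RtoC t)%C z) as T.
  pose proof (Cmod_sub_triangle (z + RtoC t)%C w z) as T'. rewrite (Cmod_minus_sym _ w) in T'.
  exists w. split; auto. split; [unfold t in *; lra|].
  intros Hin. assert (r <= Cmod (w - z)); [|unfold t in *; lra].
  apply H; auto. intros ->. rewrite Cmod_sub_diag in T'. unfold t in *; lra.
Qed.

(** [P] will be the product of the derivatives at the other points of a cycle and [t] the present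
    derivative at the free point; the new derivative [lam / P] gives the multiplier [lam]. *)
Lemma dense_quotient_off_circle (D : C -> Prop) (P t : C) (eps : R) : dense_set D -> P <> 0%C -> 0 < eps ->
  exists lam : C, D lam /\ lam <> 0%C /\ Cmod lam <> 1 /\ Cmod (lam / P - t) < eps.
Proof.
  intros HD HP He. pose proof (Cmod_pos _ HP) as HPp.
  set (e := eps * Cmod P). assert (Hee : 0 < e) by (apply Rmult_lt_0_compat; auto).
  (* First comes a target [s] close to [t * P], neither 0 nor on the unit circle; a [lam] close
     enough to [s] inherits this. *)
  assert (Hs : exists s : C, Cmod (s - t * P) <= e / 2 /\ 0 < Cmod s /\ Cmod s <> 1).
  { set (c := Rmin e 1 / 4). assert (Hm : 0 < Rmin e 1) by (apply Rmin_pos; lra).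
    pose proof (Rmin_l e 1). pose proof (Rmin_r e 1).
    assert (Hc : 0 < c) by (unfold c; lra). assert (Hce : c <= e / 4 /\ c <= 1 / 4) by (unfold c; lra).
    destruct (classic (t * P = 0)%C) as [E0|E0].
    - exists (RtoC c). rewrite E0. replace (RtoC c - 0)%C with (RtoC c) by ring.
      rewrite Cmod_R, Rabs_pos_eq; lra.
    - destruct (Req_dec (Cmod (t * P)) 1) as [E1|E1].
      + exists ((1 + RtoC c) * (t * P))%C.
        replace ((1 + RtoC c) * (t * P) - t * P)%C with (RtoC c * (t * P))%C by ring.
        replace (1 + RtoC c)%C with (RtoC (1 + c)) by (unfold RtoC, Cplus; simpl; f_equal; ring).
        rewrite (Cmod_mult (RtoC c)), (Cmod_mult (RtoC (1 + c))), E1, !Cmod_R, !Rabs_pos_eq; lra.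
      + exists (t * P)%C. rewrite Cmod_sub_diag. pose proof (Cmod_pos _ E0). lra. }
  destruct Hs as [s [S1 [S2 S3]]].
  set (r := Rmin (e / 2) (Rmin (Cmod s) (Rabs (Cmod s - 1)))).
  assert (Hr : 0 < r).
  { repeat apply Rmin_pos; auto; [lra|]. apply Rabs_pos_lt. lra. }
  destruct (HD s r Hr) as [lam [L1 L2]].
  assert (r <= e / 2) by apply Rmin_l.
  assert (r <= Rmin (Cmod s) (Rabs (Cmod s - 1))) by apply Rmin_r.
  pose proof (Rmin_l (Cmod s) (Rabs (Cmod s - 1))). pose proof (Rmin_r (Cmod s) (Rabs (Cmod s - 1))).
  pose proof (Cmod_le_sub lam s) as T1. pose proof (Cmod_le_sub s lam) as T2. rewrite (Cmod_minus_sym s) in T2.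
  exists lam. split; [auto|split; [|split]].
  - apply Cmod_pos_neq. lra.
  - intros E1. assert (Rabs (Cmod s - 1) <= Cmod (lam - s)); [|lra]. apply Rabs_le. lra.
  - replace (lam / P - t)%C with ((lam - t * P) / P)%C by (field; auto).
    rewrite Cmod_div by auto. apply Rmult_lt_reg_r with (Cmod P); auto.
    unfold Rdiv. rewrite Rmult_assoc, Rinv_l, Rmult_1_r by lra. fold e.
    pose proof (Cmod_sub_triangle lam s (t * P)%C). lra.
Qed.

(** * Neighbourhoods in the space of maps *)

Definition near (p : nat -> (C -> C) -> R) (N : nat) (eps : R) (f g : C -> C) : Prop :=
  forall n, (n <= N)%nat -> p n (fsub g f) < eps.

Section FrechetTopology.

Variables (F : (C -> C) -> Prop) (p : nat -> (C -> C) -> R).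
Hypothesis HF : FrechetEntire F p.
Hypothesis Hpoly : forall f, is_poly_map f -> F f.
Hypothesis Hfine : finer_than_local_uniform F p.

(** Only members of [F] are tested, since the seminorm laws hold on [F] alone. *)
Definition nbhd (f : C -> C) (U : (C -> C) -> Prop) : Prop :=
  exists N eps, 0 < eps /\ forall g, F g -> near p N eps f g -> U g.

Definition seminorm_open (U : (C -> C) -> Prop) : Prop := forall f, F f -> U f -> nbhd f U.

Lemma fsub_eq f g : fsub f g = fadd f (fscal (- (1))%C g).
Proof. apply functional_extensionality. intros z. unfold fsub, fadd, fscal. ring. Qed.

Lemma F_sub f g : F f -> F g -> F (fsub f g).
Proof. intros Hf Hg. rewrite fsub_eq. apply (fr_add _ _ HF); auto. apply (fr_scal _ _ HF); auto. Qed.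

Lemma p_sub_sym n f g : F f -> F g -> p n (fsub f g) = p n (fsub g f).
Proof.
  intros Hf Hg. replace (fsub f g) with (fscal (- (1))%C (fsub g f)).
  - rewrite (fr_homog _ _ HF) by now apply F_sub. rewrite Cmod_opp, Cmod_1. ring.
  - apply functional_extensionality. intros z. unfold fsub, fscal. ring.
Qed.

Lemma p_sub_triangle n f g k : F f -> F g -> F k -> p n (fsub f k) <= p n (fsub f g) + p n (fsub g k).
Proof.
  intros Hf Hg Hk. replace (fsub f k) with (fadd (fsub f g) (fsub g k)).
  - apply (fr_triangle _ _ HF); apply F_sub; auto.
  - apply functional_extensionality. intros z. unfold fsub, fadd. ring.
Qed.

Lemma p_sub_diag n f : F f -> p n (fsub f f) = 0.
Proof.
  intros Hf. replace (fsub f f) with (fscal 0%C f).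
  - rewrite (fr_homog _ _ HF) by auto. rewrite Cmod_0. ring.
  - apply functional_extensionality. intros z. unfold fsub, fscal. ring.
Qed.

Lemma near_refl N eps f : F f -> 0 < eps -> near p N eps f f.
Proof. intros Hf He n _. now rewrite p_sub_diag. Qed.

Lemma nbhd_mono f (U V : (C -> C) -> Prop) : (forall g, F g -> U g -> V g) -> nbhd f U -> nbhd f V.
Proof. intros H [N [eps [He H1]]]. exists N, eps. auto. Qed.

Lemma nbhd_inter f U V : nbhd f U -> nbhd f V -> nbhd f (fun g => U g /\ V g).
Proof.
  intros [N [eps [He H]]] [N' [eps' [He' H']]]. exists (max N N'), (Rmin eps eps').
  split; [now apply Rmin_pos|]. pose proof (Rmin_l eps eps'). pose proof (Rmin_r eps eps').
  intros g Hg Hn. split; [apply H|apply H']; auto; intros n Hle; specialize (Hn n ltac:(lia)); lra.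
Qed.

Lemma near_open N eps f : F f -> seminorm_open (near p N eps f).
Proof.
  intros Hf g Hg Hn.
  assert (Hm : exists e, 0 < e /\ forall n, (n <= N)%nat -> p n (fsub g f) + e <= eps).
  { revert Hn. induction N as [|M IH]; intros Hn.
    - specialize (Hn O (le_n O)). exists (eps - p O (fsub g f)). split; [lra|].
      intros n Hle. replace n with O by lia. lra.
    - destruct IH as [e [He H]]. { intros n Hle. apply Hn. lia. }
      specialize (Hn (S M) (le_n _)). exists (Rmin e (eps - p (S M) (fsub g f))).
      split; [apply Rmin_pos; lra|]. intros n Hle.
      pose proof (Rmin_l e (eps - p (S M) (fsub g f))). pose proof (Rmin_r e (eps - p (S M) (fsub g f))).
      destruct (Nat.eq_dec n (S M)) as [->|Hne]; [lra|]. specialize (H n ltac:(lia)). lra. }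
  destruct Hm as [e [He H]]. exists N, e. split; auto.
  intros k Hk Hkn n Hle. pose proof (p_sub_triangle n k g f Hk Hg Hf). specialize (H n Hle). specialize (Hkn n Hle). lra.
Qed.

Lemma nbhd_open f U : F f -> nbhd f U -> exists V, seminorm_open V /\ V f /\ forall g, F g -> V g -> U g.
Proof.
  intros Hf [N [eps [He H]]]. exists (near p N eps f). split; [now apply near_open|].
  split; auto. now apply near_refl.
Qed.

Lemma nbhd_disc f rho delta : F f -> 0 < delta ->
  nbhd f (fun g => forall z, Cmod z <= rho -> Cmod (g z - f z) < delta).
Proof.
  intros Hf Hd. destruct (Hfine (Rmax rho 1) delta) as [N [eps [He H]]]; auto.
  { pose proof (Rmax_r rho 1). lra. }
  exists N, eps. split; auto. intros g Hg Hn z Hz.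
  apply (H (fsub g f)); auto. { now apply F_sub. } pose proof (Rmax_l rho 1). lra.
Qed.

Lemma F_bounded_poly D s q : bounded_poly D s q -> F q.
Proof. intros H. eapply Hpoly, is_poly_of_bounded, H. Qed.

Lemma csum_S a n : csum a (S n) = (csum a n + a (S n))%C.
Proof. reflexivity. Qed.

Lemma F_pow k : F (fun z => Cpow z k).
Proof.
  apply Hpoly. exists (fun i => if Nat.eq_dec i k then RtoC 1 else RtoC 0), k. intros z.
  assert (H : forall n, csum (fun i => (if Nat.eq_dec i k then RtoC 1 else RtoC 0) * Cpow z i)%C n =
     if le_dec k n then Cpow z k else RtoC 0).
  { induction n as [|n IH].
    - unfold csum. destruct (Nat.eq_dec 0 k) as [<-|]; destruct (le_dec _ 0); try lia; ring.
    - rewrite csum_S, IH. destruct (Nat.eq_dec (S n) k) as [<-|];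
      destruct (le_dec _ n); destruct (le_dec _ (S n)); try lia; ring. }
  rewrite H. destruct (le_dec k k); [auto|lia].
Qed.

Lemma seminorm_bounded_poly n D s q : bounded_poly D s q ->
  p n q <= s * sum_f_R0 (fun k => p n (fun z => Cpow z k)) D.
Proof.
  intros [a [A1 [_ H]]].
  replace q with (fun z => csum (fun k => a k * Cpow z k)%C D) by (apply functional_extensionality; auto).
  clear H.
  assert (Ht : forall k, p n (fun z => a k * Cpow z k)%C <= s * p n (fun z => Cpow z k)).
  { intros k. change (fun z => a k * Cpow z k)%C with (fscal (a k) (fun z => Cpow z k)).
    rewrite (fr_homog _ _ HF n (a k) (fun z => Cpow z k)) by apply F_pow.
    apply Rmult_le_compat_r; auto. apply (fr_nonneg _ _ HF), F_pow. }
  assert (HFt : forall k, F (fun z => a k * Cpow z k)%C).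
  { intros k. apply (fr_scal _ _ HF (a k) (fun z => Cpow z k)), F_pow. }
  enough (F (fun z => csum (fun k => a k * Cpow z k)%C D) /\
    p n (fun z => csum (fun k => a k * Cpow z k)%C D) <= s * sum_f_R0 (fun k => p n (fun z => Cpow z k)) D) by tauto.
  induction D as [|D [IH1 IH2]]; [split; [apply (HFt O)|apply (Ht O)]|]. split.
  - apply (fr_add _ _ HF _ _ IH1 (HFt (S D))).
  - rewrite tech5, Rmult_plus_distr_l. eapply Rle_trans; [apply (fr_triangle _ _ HF n _ _ IH1 (HFt (S D)))|].
    apply Rplus_le_compat; auto.
Qed.

(** The monomials up to degree [D] have fixed seminorms, so small coefficients make finitely many
    seminorms of [q] small at once. *)
Lemma nbhd_bounded_poly f U D : F f -> nbhd f U -> exists s, 0 < s /\ forall q, bounded_poly D s q ->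
  F (fun z => f z + q z)%C /\ U (fun z => f z + q z)%C.
Proof.
  intros Hf [N [eps [He HU]]].
  assert (Hs : exists s, 0 < s /\ forall q, bounded_poly D s q -> forall n, (n <= N)%nat -> p n q < eps).
  { clear HU. induction N as [|N [s [Hs IH]]].
    - pose (Sm := sum_f_R0 (fun k => p O (fun z => Cpow z k)) D).
      assert (HS : 0 <= Sm) by (apply cond_pos_sum; intros; apply (fr_nonneg _ _ HF), F_pow).
      exists (eps / (2 * (Sm + 1))). split; [apply Rdiv_lt_0_compat; lra|].
      intros q Hq n Hn. replace n with O by lia. eapply Rle_lt_trans; [apply seminorm_bounded_poly, Hq|]. fold Sm.
      apply Rle_lt_trans with (eps / (2 * (Sm + 1)) * (Sm + 1)).
      + apply Rmult_le_compat_l; [|lra]. left. apply Rdiv_lt_0_compat; lra.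
      + apply Rle_lt_trans with (eps / 2); [right; field; lra|lra].
    - pose (Sm := sum_f_R0 (fun k => p (S N) (fun z => Cpow z k)) D).
      assert (HS : 0 <= Sm) by (apply cond_pos_sum; intros; apply (fr_nonneg _ _ HF), F_pow).
      exists (Rmin s (eps / (2 * (Sm + 1)))).
      assert (He2 : 0 < eps / (2 * (Sm + 1))) by (apply Rdiv_lt_0_compat; lra).
      split; [now apply Rmin_pos|].
      intros q Hq n Hn. destruct (Nat.eq_dec n (S N)) as [->|Hne].
      + eapply Rle_lt_trans; [apply seminorm_bounded_poly, Hq|]. fold Sm.
        apply Rle_lt_trans with (eps / (2 * (Sm + 1)) * (Sm + 1)).
        * apply Rmult_le_compat; try lra; [left; now apply Rmin_pos|apply Rmin_r].
        * apply Rle_lt_trans with (eps / 2); [right; field; lra|lra].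
      + apply IH; [|lia]. apply bounded_poly_mono with (3 := Hq); [lia|apply Rmin_l]. }
  destruct Hs as [s [Hs H]]. exists s. split; auto. intros q Hq.
  assert (Fq : F q) by (eapply F_bounded_poly; eauto).
  assert (Ff : F (fun z => f z + q z)%C) by (apply (fr_add _ _ HF f q); auto).
  split; auto. apply HU; auto. intros n Hn.
  replace (fsub (fun z => f z + q z)%C f) with q; [now apply H|].
  apply functional_extensionality. intros z. unfold fsub. ring.
Qed.

(** Hermite interpolation carried into [F]. The tolerance [eta] comes before [om], [v] and [d],
    which can therefore be picked afterwards from the dense sets. *)
Lemma interpolation f A L U : F f -> seminorm_open U -> U f -> NoDup L -> (forall z, In z L -> ~ In z A) ->
  exists eta, 0 < eta /\ forall om v d : C -> C,
  (forall z, In z L -> Cmod (om z - z) < eta /\ Cmod (v z - f z) < eta /\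
     exists l, has_cderiv f (om z) l /\ Cmod (d z - l) < eta) ->
  exists g, F g /\ U g /\ agree A f g /\ forall z, In z L -> g (om z) = v z /\ has_cderiv g (om z) (d z).
Proof.
  intros Hf HU HUf ND Hdis.
  destruct (nbhd_bounded_poly f U (2 * (length A + length L)) Hf (HU f Hf HUf)) as [s [Hs H]].
  destruct (hermite_interpolation f A L (fr_entire _ _ HF f Hf) ND Hdis s Hs) as [eta [He Hq]].
  exists eta. split; auto. intros om v d Hc. destruct (Hq om v d Hc) as [q [Q1 [Q2 Q3]]].
  destruct (H q Q1) as [G1 G2]. exists (fun z => f z + q z)%C. split; [auto|split; [auto|split; auto]].
  intros a Ha. destruct (Q2 a Ha) as [V D]. split.
  - rewrite V. ring.
  - intros l Hl. eapply cderiv_eq; [apply cderiv_plus; eauto|ring].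
Qed.

(** * Locking values, preimages and cycles *)

Variables (E Lam : C -> Prop).
Hypothesis HE : dense_set E.
Hypothesis HLam : dense_set Lam.

(* Multipliers off the unit circle keep all iterates of a cycle's first return map away from multiplier 1, so
   that points of cycles inside [A] are simple zeros of [f^n - id] for every multiple [n] of the period. *)
Definition admissible (f : C -> C) (A : list C) : Prop :=
  forall a, In a A -> E a /\ E (f a) /\ (forall l : C, has_cderiv f a l -> l <> 0%C) /\
    (orbit_in A f a -> forall n l, (1 <= n)%nat -> iterate f n a = a -> has_cderiv (iterate f n) a l ->
      Cmod l <> 1 /\ (exact_period f a n -> Lam l)).

Lemma admissible_agree f g A : entire f -> entire g -> agree A f g -> admissible f A -> admissible g A.
Proof.
  intros Hf Hg H Hadm a Ha. destruct (Hadm a Ha) as [A1 [A2 [A3 A4]]]. destruct (H a Ha) as [V D].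
  split; auto. split; [now rewrite V|]. split.
  - intros l Hl. apply A3. destruct (Hf a) as [l' Hl']. now rewrite (cderiv_unique _ _ _ _ Hl (D _ Hl')).
  - intros Ho n l Hn Hi Hl.
    assert (Hof : orbit_in A f a) by (apply (agree_orbit_in A g f); auto; now apply agree_sym).
    pose proof (agree_orbit A f g a Hf H Hof) as Hag.
    assert (Hl' : has_cderiv (iterate f n) a l).
    { destruct (Hag n) as [_ [l' [L1 L2]]]. now rewrite (cderiv_unique _ _ _ _ Hl L2). }
    destruct (Hag n) as [En _]. destruct (A4 Hof n l Hn) as [B1 B2]; auto. { now rewrite <- En. }
    split; auto. intros [P1 [P2 P3]]. apply B2. split; auto. split; [now rewrite <- En|].
    intros m M1 M2. destruct (Hag m) as [<- _]. auto.
Qed.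

Definition extends (f : C -> C) (A : list C) (U : (C -> C) -> Prop) (g : C -> C) (A' : list C) : Prop :=
  F g /\ U g /\ incl A A' /\ agree A f g /\ admissible g A'.

Lemma extends_refl f A (U : (C -> C) -> Prop) : F f -> U f -> admissible f A -> extends f A U f A.
Proof.
  intros Hf HU Hadm. split; auto. split; auto. split; [apply incl_refl|]. split; auto using agree_refl.
Qed.

Lemma extends_trans f A (U V : (C -> C) -> Prop) g A' k A'' : (forall h, F h -> V h -> U h) ->
  extends f A U g A' -> extends g A' V k A'' -> extends f A U k A''.
Proof.
  intros HVU [G1 [G2 [G3 [G4 G5]]]] [K1 [K2 [K3 [K4 K5]]]].
  split; auto. split; auto. split; [eapply incl_tran; eauto|]. split; auto.
  eapply agree_trans; eauto.
Qed.

(* [P] can be forced, by a small change of [f] that respects [A], in such a way that it persists under all later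
   changes. *)
Definition lockable (P : (C -> C) -> Prop) : Prop :=
  forall f A U, F f -> admissible f A -> seminorm_open U -> U f ->
    exists g A' V, extends f A U g A' /\ seminorm_open V /\ V g /\ (forall k, F k -> V k -> U k) /\
      forall k, F k -> agree A' g k -> V k -> P k.

Lemma lockable_and P Q : lockable P -> lockable Q -> lockable (fun k => P k /\ Q k).
Proof.
  intros HP HQ f A U Hf Hadm HU HUf.
  destruct (HP f A U Hf Hadm HU HUf) as [g [A' [V [Hext [HV [HVg [HVU HPk]]]]]]].
  destruct (HQ g A' V) as [g2 [A2 [V2 [Hext2 [HV2 [HVg2 [HVU2 HQk]]]]]]]; auto; try apply Hext.
  exists g2, A2, V2. split; [eapply extends_trans; eauto|].
  split; [auto|split; [auto|split; auto]].
  intros k Hk Hag Hv. split; auto. apply HPk; auto.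
  destruct Hext2 as [_ [_ [Hi [Ha _]]]]. eapply agree_trans; eauto.
Qed.

(** Serves the enumeration of [E], which may also list points outside [E]; conditions on those are
    void. *)
Lemma lockable_impl (S : Prop) P : (S -> lockable P) -> lockable (fun k => S -> P k).
Proof.
  intros H. destruct (classic S) as [h|h].
  - intros f A U Hf Hadm HU HUf. destruct (H h f A U Hf Hadm HU HUf) as [g [A' [V HV]]].
    exists g, A', V. intuition.
  - intros f A U Hf Hadm HU HUf. exists f, A, U. split; [now apply extends_refl|]. intuition.
Qed.

Lemma nonzero_near (c : C) (eta : R) : 0 < eta -> exists d : C, d <> 0%C /\ Cmod (d - c) < eta.
Proof.
  intros He. destruct (classic (c = 0%C)) as [->|n].
  - exists (RtoC (eta / 2)). replace (RtoC (eta / 2) - 0)%C with (RtoC (eta / 2)) by ring.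
    assert (Hm : Cmod (RtoC (eta / 2)) = eta / 2) by (rewrite Cmod_R; apply Rabs_pos_eq; lra).
    split; [apply Cmod_pos_neq|]; lra.
  - exists c. rewrite Cmod_sub_diag. auto.
Qed.

(* The last hypothesis on [w] and [v] ensures that no new cycle is closed inside [w :: A]. *)
Lemma add_point f A U z0 : F f -> admissible f A -> seminorm_open U -> U f -> ~ In z0 A ->
  exists eta, 0 < eta /\ forall w v, Cmod (w - z0) < eta -> Cmod (v - f z0) < eta -> E w -> E v -> v <> w ->
    (~ In v A \/ forall a, In a A -> f a <> w) ->
    exists g, extends f A U g (w :: A) /\ g w = v /\ exists l : C, l <> 0%C /\ has_cderiv g w l.
Proof.
  intros Hf Hadm HU HUf Hz0.
  destruct (interpolation f A (z0 :: nil) U Hf HU HUf) as [eta [He H]].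
  { constructor; [intros []|constructor]. } { intros z [<-|[]]. auto. }
  exists eta. split; auto. intros w v Hw Hv Ew Ev Hvw Hno.
  destruct (fr_entire _ _ HF f Hf w) as [l Hl]. destruct (nonzero_near l eta He) as [d [Hd0 Hd]].
  destruct (H (fun _ => w) (fun _ => v) (fun _ => d)) as [g [G1 [G2 [G3 G4]]]].
  { intros z [<-|[]]. eauto. }
  destruct (G4 z0 (or_introl eq_refl)) as [Gv Gd].
  pose proof (fr_entire _ _ HF g G1) as Hge. pose proof (fr_entire _ _ HF f Hf) as Hfe.
  exists g. split; [|split; eauto].
  split; [auto|split; [auto|split; [now right; auto|split; auto]]].
  assert (HadmA : admissible g A) by (apply admissible_agree with f; auto).
  (* A cycle in [w :: A] through [w] would pass from [w] to [v], which fails if [v] is outside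
     [w :: A], and would enter [w] from a point of the list, which fails if [w] is not an image of
     [A] and [v <> w]. *)
  assert (Hcyc : forall a n, (1 <= n)%nat -> iterate g n a = a -> orbit_in (w :: A) g a -> orbit_in A g a).
  { intros a n Hn Hper Ho k. destruct (Ho k) as [e|]; auto. exfalso.
    pose proof (Ho (S k)) as Hs. simpl in Hs. fold (iterate g k a) in Hs. change (Nat.iter k g a) with (iterate g k a) in Hs.
    rewrite <- e, Gv in Hs. destruct Hs as [Hs|Hs]; [now destruct Hvw|].
    destruct Hno as [Hno|Hno]; [auto|].
    assert (E1 : iterate g (k + n) a = w) by (rewrite iterate_add, Hper; auto).
    replace (k + n)%nat with (S (k + n - 1)) in E1 by lia.
    change (g (iterate g (k + n - 1) a) = w) in E1.
    destruct (Ho (k + n - 1)%nat) as [e'|Hin].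
    - rewrite <- e', Gv in E1. auto.
    - destruct (G3 _ Hin) as [V _]. rewrite V in E1. now apply (Hno _ Hin). }
  intros a [<-|Ha].
  - split; [auto|]. split; [now rewrite Gv|]. split.
    + intros l' Hl'. now rewrite (cderiv_unique _ _ _ _ Hl' Gd).
    + intros Ho n l' Hn Hper. pose proof (Hcyc w n Hn Hper Ho) as Ho'.
      destruct (HadmA w (Ho' O)) as [_ [_ [_ A4]]]. now apply A4.
  - destruct (HadmA a Ha) as [A1 [A2 [A3 A4]]]. split; [auto|split; [auto|split; auto]].
    intros Ho n l' Hn Hper. apply A4; auto. now apply (Hcyc a n).
Qed.

Lemma lockable_value e : E e -> lockable (fun k => E (k e)).
Proof.
  intros He f A U Hf Hadm HU HUf. destruct (classic (In e A)) as [Hin|Hin].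
  - exists f, A, U. split; [now apply extends_refl|]. repeat split; auto.
    intros k _ Hag _. destruct (Hag e Hin) as [-> _]. now apply Hadm.
  - destruct (add_point f A U e Hf Hadm HU HUf Hin) as [eta [Heta H]].
    (* With [v] outside [e :: A] an orbit through [e] leaves the list at once. The value at [e] is
       then frozen by agreement, so [U] itself can serve as [V]. *)
    destruct (dense_avoiding_list E (e :: A) (f e) eta HE Heta) as [v [V1 [V2 V3]]].
    destruct (H e v) as [g [G1 [G2 _]]]; auto.
    { now rewrite Cmod_sub_diag. } { intros ->. apply V3. now left. } { left. intros h. apply V3. now right. }
    exists g, (e :: A), U. split; auto. split; auto. split; [apply G1|]. split; auto.
    intros k _ Hag _. destruct (Hag e (or_introl eq_refl)) as [-> _]. now rewrite G2.
Qed.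

Lemma nonzero_value_near (f : C -> C) (w l : C) : l <> 0%C -> has_cderiv f w l ->
  exists z, Cmod (z - w) < 1 /\ f z <> 0%C.
Proof.
  intros Hl H. apply NNPP. intros N. apply Hl. apply (cderiv_unique f w); auto.
  apply cderiv_ext_loc with (fun _ => 0%C) 1; [lra| |apply cderiv_const].
  intros y Hy. symmetry. apply NNPP. intros n. apply N. eauto.
Qed.

Section LockZeros.

Variables (T : (C -> C) -> C -> C) (locked : (C -> C) -> list C -> C -> Prop) (rho : R).
Hypothesis Hrho : 0 <= rho.
Hypothesis lock_one : forall f A U z, F f -> admissible f A -> seminorm_open U -> U f ->
  Cmod z <= rho -> T f z = 0%C -> ~ locked f A z ->
  exists g A' w, extends f A U g A' /\ locked g A' w /\ ~ locked f A w /\ Cmod w <= rho + 1.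
Hypothesis locked_persistent : forall f A g A' w, F f -> F g -> locked f A w -> incl A A' -> agree A f g ->
  locked g A' w.
Hypothesis locked_simple : forall f A w, F f -> admissible f A -> locked f A w ->
  T f w = 0%C /\ exists l : C, l <> 0%C /\ has_cderiv (T f) w l.
Hypothesis T_entire : forall f, F f -> entire (T f).
Hypothesis T_continuous : forall f r delta, F f -> 0 < delta ->
  nbhd f (fun g => forall z, Cmod z <= r -> Cmod (T g z - T f z) < delta).

Definition all_locked (f : C -> C) (A : list C) : Prop :=
  forall z, Cmod z <= rho -> T f z = 0%C -> locked f A z.

(** Each use of [lock_one] adds to [l] a zero that was not locked before, hence a new one, and the
    earlier ones persist. Inside [U] the list cannot outgrow [N], so [m] bounds the number of moves
    left. *)
Lemma lock_all_bounded (N : nat) (r1 : R) (U : (C -> C) -> Prop) : seminorm_open U -> rho + 1 <= r1 ->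
  (forall g l, F g -> U g -> NoDup l -> (forall w, In w l -> T g w = 0%C /\ Cmod w <= r1) -> (length l <= N)%nat) ->
  forall m f A l, F f -> U f -> admissible f A -> NoDup l ->
    (forall w, In w l -> locked f A w /\ Cmod w <= r1) -> (N < length l + m)%nat ->
    exists g A', extends f A U g A' /\ all_locked g A'.
Proof.
  intros HU Hr1 HN m. induction m as [|m IH]; intros f A l Hf HUf Hadm ND Hl Hm.
  - exfalso. assert (length l <= N)%nat; [|lia]. apply HN with f; auto.
    intros w Hw. destruct (Hl w Hw) as [H1 H2]. split; auto. now apply (locked_simple f A).
  - destruct (classic (all_locked f A)) as [Hall|Hnot].
    { exists f, A. split; auto. now apply extends_refl. }
    apply not_all_ex_not in Hnot. destruct Hnot as [z Hz].
    apply imply_to_and in Hz. destruct Hz as [Hz1 Hz]. apply imply_to_and in Hz. destruct Hz as [Hz2 Hz3].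
    destruct (lock_one f A U z) as [g [A' [w [Hext [W1 [W2 W3]]]]]]; auto.
    pose proof Hext as [X1 [X2 [X3 [X4 X5]]]].
    destruct (IH g A' (w :: l)) as [k [A'' [K1 K2]]]; auto.
    + constructor; auto. intros Hin. apply W2. now apply Hl.
    + intros y [<-|Hy]; [split; [auto|lra]|]. destruct (Hl y Hy). split; auto.
      now apply (locked_persistent f A).
    + simpl. lia.
    + exists k, A''. split; auto. eapply extends_trans; [|exact Hext|exact K1]. auto.
Qed.

(* A first locked zero makes [T] not identically zero, so that near [f] the number of zeros in a disc is
   bounded; locking zeros one after the other then terminates. *)
Lemma lock_all f A U : F f -> admissible f A -> seminorm_open U -> U f ->
  exists g A', extends f A U g A' /\ all_locked g A'.
Proof.
  intros Hf Hadm HU HUf. destruct (classic (all_locked f A)) as [Hall|Hnot].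
  { exists f, A. split; auto. now apply extends_refl. }
  apply not_all_ex_not in Hnot. destruct Hnot as [z Hz].
  apply imply_to_and in Hz. destruct Hz as [Hz1 Hz]. apply imply_to_and in Hz. destruct Hz as [Hz2 Hz3].
  destruct (lock_one f A U z) as [f1 [A1 [w [Hext [W1 [W2 W3]]]]]]; auto.
  pose proof Hext as [X1 [X2 [X3 [X4 X5]]]].
  destruct (locked_simple f1 A1 w X1 X5 W1) as [_ [l [l0 Hl]]].
  destruct (nonzero_value_near _ _ _ l0 Hl) as [z0 [Hz0 Hz0']].
  assert (Hz0r : Cmod z0 <= rho + 2) by (pose proof (Cmod_le_sub z0 w); lra).
  (* The locked zero may have modulus up to [rho + 1], and [z0] is within 1 of it. *)
  destruct (zero_count_stable (T f1) (rho + 2) z0) as [N [delta [Hdelta HN]]]; auto; [lra|].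
  destruct (nbhd_open f1 _ X1 (nbhd_inter _ _ _ (HU f1 X1 X2) (T_continuous f1 (5 * (rho + 2)) delta X1 Hdelta)))
    as [U1 [O1 [O2 O3]]].
  destruct (lock_all_bounded N (rho + 2) U1 O1 ltac:(lra)) with (m := S N) (f := f1) (A := A1) (l := @nil C)
    as [g [A' [G1 G2]]]; auto.
  - intros g l' Hg HUg. apply HN; auto. now apply O3.
  - constructor.
  - intros y [].
  - exists g, A'. split; auto. eapply extends_trans; [|exact Hext|exact G1]. intros h Hh HU1. now apply O3.
Qed.

(** [V] is cut down to make [simple_zeros_stable] applicable: a later map that agrees with [g] on
    [A'] keeps the zeros of [T g] in the disc, all of them locked, and acquires no others there. *)
Lemma lockable_zeros (P : (C -> C) -> Prop) :
  (forall k A, F k -> admissible k A -> all_locked k A -> P k) -> lockable P.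
Proof.
  intros HP f A U Hf Hadm HU HUf.
  destruct (lock_all f A U Hf Hadm HU HUf) as [g [A' [Hext Hall]]].
  pose proof Hext as [X1 [X2 [X3 [X4 X5]]]].
  destruct (simple_zeros_stable (T g) rho (T_entire g X1)) as [delta [Hdelta Hst]].
  { intros z Hz H0. apply (locked_simple g A'); auto. }
  destruct (nbhd_open g _ X1 (nbhd_inter _ _ _ (HU g X1 X2) (T_continuous g (rho + 1) delta X1 Hdelta)))
    as [V [O1 [O2 O3]]].
  exists g, A', V. split; auto. split; auto. split; auto. split; [intros k Hk Hv; now apply O3|].
  intros k Hk Hag Hv.
  assert (Hadmk : admissible k A').
  { apply admissible_agree with g; auto; now apply (fr_entire _ _ HF). }
  assert (Hpers : forall z, locked g A' z -> locked k A' z).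
  { intros z Hz. apply (locked_persistent g A' k A' z); auto using incl_refl. }
  apply (HP k A'); auto. intros z Hz H0. apply Hpers, Hall; auto.
  apply (Hst (T k)); auto.
  - now apply O3.
  - intros y Hy Hy0. apply (locked_simple k A'); auto.
Qed.

End LockZeros.

Lemma lockable_preimages e rho : E e -> 0 <= rho ->
  lockable (fun k => forall z, Cmod z <= rho -> k z = e -> E z).
Proof.
  intros He Hrho.
  apply lockable_zeros with (T := fun f z => (f z - e)%C) (locked := fun f A w => In w A /\ f w = e) (rho := rho); auto.
  - intros f A U z Hf Hadm HU HUf Hz H0 Hnl. apply Cminus_eq_0 in H0.
    assert (Hz0 : ~ In z A) by auto.
    destruct (add_point f A U z Hf Hadm HU HUf Hz0) as [eta [Heta H]].
    (* [e] may well belong to [A], so new cycles are excluded by the second alternative in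
       [add_point]: [w] is no image of a point of [A]. Avoiding [e] gives [v <> w], and avoiding [A]
       makes the new zero differ from those already locked. *)
    destruct (dense_avoiding_list E (e :: A ++ map f A) z (Rmin eta 1) HE) as [w [W1 [W2 W3]]].
    { apply Rmin_pos; lra. }
    pose proof (Rmin_l eta 1). pose proof (Rmin_r eta 1).
    destruct (H w e) as [g [G1 [G2 G3]]]; auto; [lra| | | |].
    + rewrite H0, Cmod_sub_diag. auto.
    + intros ->. apply W3. now left.
    + right. intros a Ha <-. apply W3. right. apply in_or_app. right. now apply in_map.
    + exists g, (w :: A), w. split; auto. split; [split; [now left|auto]|]. split.
      * intros [Hin _]. apply W3. right. apply in_or_app. now left.
      * pose proof (Cmod_le_sub w z). lra.
  - intros f A g A' w _ _ [H1 H2] Hi Hag. split; auto. destruct (Hag w H1) as [-> _]. auto.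
  - intros f A w Hf Hadm [H1 H2]. split; [rewrite H2; ring|].
    destruct (fr_entire _ _ HF f Hf w) as [l Hl]. destruct (Hadm w H1) as [_ [_ [A3 _]]].
    exists l. split; auto. eapply cderiv_eq; [apply cderiv_minus; [exact Hl|apply cderiv_const]|ring].
  - intros f Hf. apply entire_minus; [now apply (fr_entire _ _ HF)|apply entire_const].
  - intros f r delta Hf Hd. eapply nbhd_mono; [|apply (nbhd_disc f r delta Hf Hd)].
    intros g _ H z Hz. replace (g z - e - (f z - e))%C with (g z - f z)%C by ring. auto.
  - intros k A Hk Hadm Hall z Hz Hkz. apply Hadm. apply Hall; auto. rewrite Hkz. ring.
Qed.

(** A point of the moved cycle returns only after [m * q] steps, with derivative [lam ^ q] of
    modulus other than 1; this is the multiplier of the cycle only for [q = 1]. *)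
Lemma cycle_admissible f A g x m (om d : C -> C) lam : entire g ->
  exact_period f x m -> admissible g A ->
  (forall k, E (om (iterate f k x)) /\ g (om (iterate f k x)) = om (iterate f (S k) x) /\
     has_cderiv g (om (iterate f k x)) (d (iterate f k x)) /\ d (iterate f k x) <> 0%C) ->
  (forall i j, om (iterate f i x) = om (iterate f j x) -> iterate f i x = iterate f j x) ->
  orbit_prod f d m x = lam -> Lam lam -> Cmod lam <> 1 ->
  admissible g (map om (orbit_list f x m) ++ A).
Proof.
  intros Hg Hper HadmA Horb Hinj Hlam HL Hl1.
  pose proof Hper as [P1 [P2 P3]].
  assert (Hsemi : forall i n, iterate g n (om (iterate f i x)) = om (iterate f n (iterate f i x)) /\
     has_cderiv (iterate g n) (om (iterate f i x)) (orbit_prod f d n (iterate f i x))).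
  { intros i. apply semiconj_iterate. intros k. rewrite <- iterate_add.
    replace (iterate f (S k) (iterate f i x)) with (iterate f (S (k + i)) x) by (rewrite <- iterate_add; auto).
    destruct (Horb (k + i)%nat) as [_ [H1 [H2 _]]]. auto. }
  assert (Hin : forall k, In (om (iterate f k x)) (map om (orbit_list f x m))).
  { intros k. now apply in_map, orbit_list_complete. }
  assert (Hcyc : forall a, In a (map om (orbit_list f x m)) -> exists i, a = om (iterate f i x)).
  { intros a Ha. apply in_map_iff in Ha. destruct Ha as [y [<- Hy]].
    destruct (orbit_list_elim _ _ _ _ Hy) as [k ->]. eauto. }
  intros a Ha. destruct (classic (In a (map om (orbit_list f x m)))) as [Hc|Hnc].
  - destruct (Hcyc a Hc) as [i ->]. destruct (Horb i) as [O1 [O2 [O3 O4]]].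
    split; auto. split. { rewrite O2. apply Horb. }
    split. { intros l Hl. now rewrite (cderiv_unique _ _ _ _ Hl O3). }
    intros _ n l Hn Hfix Hl. destruct (Hsemi i n) as [S1 S2].
    rewrite S1 in Hfix. rewrite <- iterate_add in Hfix. apply Hinj in Hfix. rewrite iterate_add in Hfix.
    pose proof (exact_period_iterate f x m i Hper) as Hperi.
    destruct (exact_period_divides _ _ _ _ Hperi Hfix) as [q ->].
    rewrite (cderiv_unique _ _ _ _ Hl S2).
    rewrite orbit_prod_pow by apply Hperi. rewrite orbit_prod_iterate; [|auto|apply Horb]. rewrite Hlam.
    assert (Hq : (1 <= q)%nat) by nia.
    split.
    + rewrite Cmod_pow. intros E1. pose proof (Cmod_ge_0 lam) as L0.
      destruct (Rtotal_order (Cmod lam) 1) as [h|[h|h]]; auto.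
      * pose proof (pow_lt_1_compat (Cmod lam) q ltac:(lra) ltac:(lia)). lra.
      * pose proof (Rlt_pow_R1 (Cmod lam) q h ltac:(lia)). lra.
    + intros [_ [_ Q3]].
      assert (q = 1)%nat.
      { destruct (Nat.eq_dec q 1) as [|Hq1]; auto. exfalso. apply (Q3 m); auto; [nia|].
        destruct (Hsemi i m) as [S3 _]. rewrite S3. f_equal. apply Hperi. }
      subst q. simpl. now rewrite Cmult_1_r.
  - assert (HaA : In a A) by (apply in_app_or in Ha; tauto).
    destruct (HadmA a HaA) as [A1 [A2 [A3 A4]]]. split; auto. split; auto. split; auto.
    intros Ho n l Hn Hfix. apply A4; auto.
    (* A periodic point whose orbit meets the new cycle lies on it, since the orbit returns. So the
       orbit considered here stays in [A], where [HadmA] applies. *)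
    intros k. pose proof (Ho k) as Hk. apply in_app_or in Hk. destruct Hk as [Hk|]; auto. exfalso.
    destruct (Hcyc _ Hk) as [i Hi]. apply Hnc.
    rewrite <- (iterate_return g a n k Hn Hfix), Hi.
    destruct (Hsemi i (n * k - k)%nat) as [-> _]. rewrite <- iterate_add. apply Hin.
Qed.

(** As [x] is outside [A], the derivative there is still free and serves to bring the multiplier
    into [Lam]. Points of the cycle in [A] stay put; the others end up in [E], outside the old
    [A]. *)
Lemma lock_cycle f A U x m delta : F f -> admissible f A -> seminorm_open U -> U f ->
  exact_period f x m -> ~ In x A -> 0 < delta ->
  exists g A' om, extends f A U g A' /\ forall k,
    In (om (iterate f k x)) A' /\ g (om (iterate f k x)) = om (iterate f (S k) x) /\
    Cmod (om (iterate f k x) - iterate f k x) < delta /\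
    (In (iterate f k x) A -> om (iterate f k x) = iterate f k x) /\
    (~ In (iterate f k x) A -> ~ In (om (iterate f k x)) A).
Proof.
  intros Hf Hadm HU HUf Hper HxA Hdelta.
  pose proof Hper as [P1 [P2 P3]]. pose proof (fr_entire _ _ HF f Hf) as Hfe.
  set (L0 := orbit_list f x m).
  set (L := filter (fun z => if excluded_middle_informative (In z A) then false else true) L0).
  assert (HL : forall z, In z L <-> In z L0 /\ ~ In z A).
  { intros z. unfold L. rewrite filter_In. destruct (excluded_middle_informative (In z A)); intuition discriminate. }
  destruct (interpolation f A L U Hf HU HUf) as [eta [Heta Hint]].
  { apply NoDup_filter. now apply orbit_list_NoDup. } { intros z Hz. now apply HL. }
  destruct (list_pairwise_separated (L0 ++ A)) as [r0 [Hr0 Hsep]].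
  (* The bound [r0 / 2] keeps the moved points distinct and off [A]. *)
  set (e := Rmin eta (Rmin (r0 / 2) delta)).
  assert (He : 0 < e) by (unfold e; repeat apply Rmin_pos; lra).
  assert (He3 : e <= eta /\ e <= r0 / 2 /\ e <= delta).
  { unfold e. pose proof (Rmin_l eta (Rmin (r0 / 2) delta)). pose proof (Rmin_r eta (Rmin (r0 / 2) delta)).
    pose proof (Rmin_l (r0 / 2) delta). pose proof (Rmin_r (r0 / 2) delta). lra. }
  (* [om] fixes [E]. As [A] and its image under [f] lie in [E], the equation [g (om z) = om (f z)]
     also holds at points of [A], where [g] cannot be prescribed any more. *)
  assert (Hom : forall z, exists w, E w /\ Cmod (w - z) < e /\ (E z -> w = z)).
  { intros z. destruct (classic (E z)) as [h|h].
    - exists z. rewrite Cmod_sub_diag. auto.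
    - destruct (HE z e He) as [w [W1 W2]]. exists w. tauto. }
  set (om := fun z => proj1_sig (constructive_indefinite_description _ (Hom z))).
  assert (Hom' : forall z, E (om z) /\ Cmod (om z - z) < e /\ (E z -> om z = z)).
  { intros z. exact (proj2_sig (constructive_indefinite_description _ (Hom z))). }
  clearbody om. clear Hom.
  assert (Hder : forall z, exists l, has_cderiv f (om z) l) by (intros; apply Hfe).
  set (der := fun z => proj1_sig (constructive_indefinite_description _ (Hder z))).
  assert (Hder' : forall z, has_cderiv f (om z) (der z)).
  { intros z. exact (proj2_sig (constructive_indefinite_description _ (Hder z))). }
  clearbody der. clear Hder.
  (* Vanishing derivatives are replaced by [eta / 2], so that the product along the cycle can be
     divided by. *)
  set (d1 := fun z => if excluded_middle_informative (der z = 0%C) then RtoC (eta / 2) else der z).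
  assert (Hd1 : forall z, d1 z <> 0%C /\ Cmod (d1 z - der z) < eta).
  { intros z. unfold d1. destruct (excluded_middle_informative (der z = 0%C)) as [E0|E0].
    - assert (Hm : Cmod (RtoC (eta / 2)) = eta / 2) by (rewrite Cmod_R; apply Rabs_pos_eq; lra).
      split; [apply Cmod_pos_neq; lra|]. rewrite E0.
      replace (RtoC (eta / 2) - 0)%C with (RtoC (eta / 2)) by ring. lra.
    - rewrite Cmod_sub_diag. auto. }
  (* [d'] leaves out the factor at [x], which is then chosen so that the whole product is [lam]. *)
  set (d' := fun z => if excluded_middle_informative (z = x) then RtoC 1 else d1 z).
  assert (HP : orbit_prod f d' m x <> 0%C).
  { apply orbit_prod_neq_0. intros j _. unfold d'. destruct (excluded_middle_informative _); [apply C1_nz|apply Hd1]. }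
  destruct (dense_quotient_off_circle Lam (orbit_prod f d' m x) (der x) eta HLam HP Heta) as [lam [L1 [L2 [L3 L4]]]].
  set (dx := (lam / orbit_prod f d' m x)%C) in *.
  set (d := fun z => if excluded_middle_informative (z = x) then dx else d1 z).
  assert (Hd : forall z, d z <> 0%C /\ Cmod (d z - der z) < eta).
  { intros z. unfold d. destruct (excluded_middle_informative (z = x)) as [->|]; auto. split; auto.
    unfold dx. intros E0. apply L2. replace lam with (lam / orbit_prod f d' m x * orbit_prod f d' m x)%C by (field; auto).
    rewrite E0. ring. }
  assert (Hprod : orbit_prod f d m x = lam).
  { assert (Hk : forall k, (k < m)%nat -> orbit_prod f d (S k) x = (dx * orbit_prod f d' (S k) x)%C).
    { intros k. induction k as [|k IH]; intros Hk.
      - change (d x * 1 = dx * (d' x * 1))%C. unfold d, d'. destruct (excluded_middle_informative (x = x)) as [_|n]; [ring|now destruct n].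
      - change (orbit_prod f d (S (S k)) x) with (d (iterate f (S k) x) * orbit_prod f d (S k) x)%C.
        change (orbit_prod f d' (S (S k)) x) with (d' (iterate f (S k) x) * orbit_prod f d' (S k) x)%C.
        rewrite IH by lia.
        replace (d (iterate f (S k) x)) with (d' (iterate f (S k) x)); [ring|].
        unfold d, d'. destruct (excluded_middle_informative (iterate f (S k) x = x)) as [E0|_]; auto.
        exfalso. apply (P3 (S k)); auto; lia. }
    replace m with (S (m - 1)) by lia. rewrite Hk by lia. replace (S (m - 1)) with m by lia.
    unfold dx. field. auto. }
  assert (HO : forall k, In (iterate f k x) L0) by (intros; now apply orbit_list_complete).
  assert (HAE : forall z, In z A -> om z = z) by (intros z Hz; apply Hom'; now apply Hadm).
  destruct (Hint om (fun z => om (f z)) d) as [g [G1 [G2 [G3 G4]]]].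
  { intros z _. split; [|split].
    - destruct (Hom' z) as [_ [H _]]. lra.
    - destruct (Hom' (f z)) as [_ [H _]]. lra.
    - exists (der z). split; auto. apply Hd. }
  pose proof (fr_entire _ _ HF g G1) as Hge.
  assert (Horb : forall k, E (om (iterate f k x)) /\ g (om (iterate f k x)) = om (iterate f (S k) x) /\
     has_cderiv g (om (iterate f k x)) (d (iterate f k x)) /\ d (iterate f k x) <> 0%C).
  { intros k. split; [apply Hom'|]. rewrite <- and_assoc. split; [|apply Hd].
    change (iterate f (S k) x) with (f (iterate f k x)). pose proof (HO k) as Hk.
    set (z := iterate f k x) in *. destruct (classic (In z A)) as [HzA|HzA].
    - pose proof (Hadm z HzA) as [_ [A2 [A3 _]]]. destruct (G3 z HzA) as [V D].
      rewrite (HAE z HzA). split.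
      + rewrite V. symmetry. now apply Hom'.
      + pose proof (Hder' z) as Hz. rewrite (HAE z HzA) in Hz.
        apply D. unfold d, d1. destruct (excluded_middle_informative (z = x)) as [E0|_].
        * exfalso. apply HxA. now rewrite <- E0.
        * destruct (excluded_middle_informative (der z = 0%C)) as [E0|_]; auto.
          exfalso. now apply (A3 (der z)).
    - apply (G4 z). now apply HL. }
  assert (Hinj : forall i j, om (iterate f i x) = om (iterate f j x) -> iterate f i x = iterate f j x).
  { intros i j E0. apply NNPP. intros n.
    pose proof (Hsep _ _ (in_or_app _ A _ (or_introl (HO i))) (in_or_app _ A _ (or_introl (HO j))) n) as Hs.
    destruct (Hom' (iterate f i x)) as [_ [H1 _]]. destruct (Hom' (iterate f j x)) as [_ [H2 _]].
    rewrite E0 in H1. rewrite Cmod_minus_sym in H1.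
    pose proof (Cmod_sub_triangle (iterate f i x) (om (iterate f j x)) (iterate f j x)). lra. }
  exists g, (map om L0 ++ A), om. split.
  - split; auto. split; auto. split; [intros y Hy; apply in_or_app; now right|]. split; auto.
    apply (cycle_admissible f A g x m om d lam); auto.
    apply admissible_agree with f; auto.
  - intros k. split; [apply in_or_app; left; now apply in_map|]. split; [apply Horb|].
    split; [destruct (Hom' (iterate f k x)) as [_ [H _]]; lra|]. split; [apply HAE|].
    intros Hn Hin. destruct (Hom' (iterate f k x)) as [_ [H _]].
    assert (Hs : r0 <= Cmod (om (iterate f k x) - iterate f k x)).
    { apply Hsep; [apply in_or_app; now right|apply in_or_app; left; apply HO|].
      intros E0. apply Hn. now rewrite <- E0. }
    lra.
Qed.

(** A locked zero of [f^n - id] has its orbit inside [A]; it is simple because the derivative is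
    [l - 1] with [Cmod l <> 1]. Here [n] may be a proper multiple of the exact period, with which
    [lock_cycle] works. *)
Lemma lockable_cycles n rho : (1 <= n)%nat -> 0 <= rho ->
  lockable (fun k => forall z, Cmod z <= rho -> iterate k n z = z ->
    E z /\ forall lam, multiplier_at k z n lam -> Lam lam).
Proof.
  intros Hn Hrho.
  apply lockable_zeros with (T := fun f z => (iterate f n z - z)%C)
    (locked := fun f A w => orbit_in A f w /\ iterate f n w = w) (rho := rho); auto.
  - intros f A U z Hf Hadm HU HUf Hz H0 Hnl. apply Cminus_eq_0 in H0.
    (* The zero is not locked, so its cycle has a point [x] outside [A]; the cycle is moved from
       there, and [k0] steps lead from [x] back to [z]. *)
    assert (Hj : exists j, ~ In (iterate f j z) A).
    { apply not_all_ex_not. intros Ho. apply Hnl. split; auto. }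
    destruct Hj as [j Hj]. set (x := iterate f j z) in *.
    destruct (exists_exact_period f x n Hn) as [m Hm].
    { unfold x. now rewrite iterate_comm, H0. }
    destruct (lock_cycle f A U x m 1 Hf Hadm HU HUf Hm Hj Rlt_0_1) as [g [A' [om [Hext Hk]]]].
    assert (Hzk : iterate f (n * j - j) x = z) by now apply iterate_return.
    set (k0 := (n * j - j)%nat) in *.
    assert (Hit : forall k, iterate g k (om z) = om (iterate f (k + k0) x)).
    { induction k as [|k IH]; [simpl; now rewrite Hzk|].
      change (g (iterate g k (om z)) = om (iterate f (S (k + k0)) x)). rewrite IH. apply Hk. }
    exists g, A', (om z). split; auto. destruct (Hk k0) as [K1 [K2 [K3 [K4 K5]]]]. rewrite Hzk in *.
    split; [split|split].
    + intros k. rewrite Hit. apply Hk.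
    + now rewrite Hit, iterate_add, Hzk, H0.
    (* If [z] is in [A], then [om z] is [z], which was not locked; otherwise [om z] is not even in
       [A]. *)
    + intros [Ho _]. destruct (classic (In z A)) as [HzA|HzA].
      * rewrite (K4 HzA) in Ho. apply Hnl. auto.
      * apply (K5 HzA). apply (Ho O).
    + pose proof (Cmod_le_sub (om z) z). lra.
  - intros f A g A' w Hf Hg [H1 H2] Hi Hag.
    pose proof (agree_orbit A f g w (fr_entire _ _ HF f Hf) Hag H1) as Ho. split.
    + intros k. destruct (Ho k) as [-> _]. now apply Hi.
    + destruct (Ho n) as [-> _]. auto.
  - intros f A w Hf Hadm [H1 H2]. split; [rewrite H2; ring|].
    destruct (entire_iterate f n (fr_entire _ _ HF f Hf) w) as [l Hl].
    destruct (Hadm w (H1 O)) as [_ [_ [_ A4]]]. destruct (A4 H1 n l Hn H2 Hl) as [Hl1 _].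
    exists (l - 1)%C. split.
    + apply Cminus_neq_0. intros ->. apply Hl1. apply Cmod_1.
    + apply cderiv_minus; [exact Hl|apply cderiv_id].
  - intros f Hf. apply entire_minus; [apply entire_iterate; now apply (fr_entire _ _ HF)|apply entire_id].
  - intros f r delta Hf Hd.
    destruct (iterate_close f n r delta (fr_entire _ _ HF f Hf) Hd) as [r' [d' [Hr' [Hd' H]]]].
    eapply nbhd_mono; [|apply (nbhd_disc f r' d' Hf Hd')].
    intros g _ Hg z Hz. replace (iterate g n z - z - (iterate f n z - z))%C with (iterate g n z - iterate f n z)%C by ring.
    now apply H.
  - intros k A Hk Hadm Hall z Hz Hkz. destruct (Hall z Hz) as [Ho _].
    { rewrite Hkz. ring. }
    destruct (Hadm z (Ho O)) as [A1 [_ [_ A4]]]. split; auto.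
    intros lam [Hper Hlam]. now apply (A4 Ho n lam Hn Hkz Hlam).
Qed.

(** * Passage to the limit *)

Definition converges (u : nat -> C -> C) (g : C -> C) : Prop :=
  forall n eps, 0 < eps -> exists K, forall k, (K <= k)%nat -> p n (fsub (u k) g) < eps.

Lemma converges_near u g N eps : converges u g -> 0 < eps ->
  exists K, forall k, (K <= k)%nat -> near p N eps g (u k).
Proof.
  intros H He. induction N as [|N [K IH]].
  - destruct (H O eps He) as [K HK]. exists K. intros k Hk n Hn. replace n with O by lia. auto.
  - destruct (H (S N) eps He) as [K' HK']. exists (max K K'). intros k Hk n Hn.
    destruct (Nat.eq_dec n (S N)) as [->|Hne]; [apply HK'; lia|]. apply (IH k); lia.
Qed.

(** Values converge on discs, and [cderiv_bound] for [u k - g] makes derivatives converge too; being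
    eventually constant on [A], both equal their limits. *)
Lemma agree_limit u g A f k0 : (forall k, F (u k)) -> F f -> F g -> converges u g ->
  (forall k, (k0 <= k)%nat -> agree A f (u k)) -> agree A f g.
Proof.
  intros HFu Hf Hg Hc Hag a Ha.
  assert (Hdisc : forall delta, 0 < delta -> exists k, (k0 <= k)%nat /\
    forall z, Cmod z <= Cmod a + 1 -> Cmod (u k z - g z) < delta).
  { intros delta Hd. destruct (nbhd_disc g (Cmod a + 1) delta Hg Hd) as [N [eps [He H]]].
    destruct (converges_near u g N eps Hc He) as [K HK]. exists (max k0 K). split; [lia|].
    apply H; auto. apply HK. lia. }
  split.
  - apply NNPP. intros n. apply Cmod_sub_pos in n. destruct (Hdisc _ n) as [k [Hk H]].
    destruct (Hag k Hk a Ha) as [V _]. specialize (H a ltac:(lra)). rewrite V, Cmod_minus_sym in H. lra.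
  - intros l Hl. destruct (fr_entire _ _ HF g Hg a) as [l' Hl'].
    destruct (classic (l = l')) as [->|n]; auto. exfalso. apply Cmod_sub_pos in n.
    destruct (Hdisc (Cmod (l - l') / 4)) as [k [Hk H]]; [lra|].
    destruct (Hag k Hk a Ha) as [_ D].
    pose proof (fr_entire _ _ HF _ (HFu k)) as Hue. pose proof (fr_entire _ _ HF g Hg) as Hge.
    assert (Cmod (l - l') <= 2 * (Cmod (l - l') / 4)); [|lra].
    apply cderiv_bound with (fun z => u k z - g z)%C a (Cmod a).
    + now apply entire_minus.
    + lra.
    + intros z Hz. left. auto.
    + apply cderiv_minus; auto.
Qed.

(** Index and radius describe the ball about the map in which the condition locked last persists for
    maps that agree on the points. *)
Record stage := Stage { stage_map : C -> C; stage_points : list C; stage_index : nat; stage_radius : R }.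

Definition stage_valid (s : stage) : Prop :=
  F (stage_map s) /\ admissible (stage_map s) (stage_points s) /\ 0 < stage_radius s.

(** A move below [r / 4] followed by at least halving the radius is at most half the decrease of the
    radius, so that moves telescope. The bound [j <= stage_index s'] brings every seminorm under
    control eventually. *)
Definition stage_step (P : nat -> (C -> C) -> Prop) (j : nat) (s s' : stage) : Prop :=
  stage_valid s' /\
  near p (stage_index s) (stage_radius s / 4) (stage_map s) (stage_map s') /\
  incl (stage_points s) (stage_points s') /\ agree (stage_points s) (stage_map s) (stage_map s') /\
  (stage_index s <= stage_index s')%nat /\ (j <= stage_index s')%nat /\
  stage_radius s' <= stage_radius s / 2 /\
  forall k, F k -> agree (stage_points s') (stage_map s') k ->
    near p (stage_index s') (stage_radius s') (stage_map s') k -> P j k.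

Lemma stage_step_exists (P : nat -> (C -> C) -> Prop) j s : lockable (P j) -> stage_valid s ->
  exists s', stage_step P j s s'.
Proof.
  intros HP [Hf [Hadm Hr]]. destruct s as [f A N r]; simpl in *.
  destruct (HP f A (near p N (r / 4) f)) as [g [A' [V [[X1 [X2 [X3 [X4 X5]]]] [O1 [O2 [O3 O4]]]]]]]; auto.
  { now apply near_open. } { apply near_refl; auto. lra. }
  destruct (O1 g X1 O2) as [N' [r' [Hr' H]]].
  exists (Stage g A' (max (max N N') j) (Rmin r' (r / 2))).
  pose proof (Rmin_l r' (r / 2)). pose proof (Rmin_r r' (r / 2)).
  assert (0 < Rmin r' (r / 2)) by (apply Rmin_pos; lra).
  unfold stage_step, stage_valid; simpl.
  split; [auto|]. split; [auto|]. split; [auto|]. split; [auto|]. split; [lia|]. split; [lia|]. split; [lra|].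
  intros k Hk Hag Hn. apply O4; auto. apply H; auto. intros n Hle. specialize (Hn n ltac:(lia)). lra.
Qed.

Lemma generic_map (P : nat -> (C -> C) -> Prop) f N eps : (forall j, lockable (P j)) -> F f -> 0 < eps ->
  exists g, F g /\ near p N eps f g /\ forall j, P j g.
Proof.
  intros HP Hf He. set (s0 := Stage f nil N eps).
  set (st := fix st j := match j with O => s0 | S i => epsilon (inhabits s0) (stage_step P i (st i)) end).
  assert (Hv : forall j, stage_valid (st j)).
  { induction j as [|j IH].
    - split; auto. split; auto. intros a [].
    - apply (epsilon_spec (inhabits s0) _ (stage_step_exists P j (st j) (HP j) IH)). }
  assert (Hs : forall j, stage_step P j (st j) (st (S j))).
  { intros j. apply (epsilon_spec (inhabits s0) _ (stage_step_exists P j (st j) (HP j) (Hv j))). }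
  set (u := fun j => stage_map (st j)). set (r := fun j => stage_radius (st j)).
  set (I := fun j => stage_index (st j)). set (A := fun j => stage_points (st j)).
  assert (HFu : forall j, F (u j)) by (intros; apply Hv).
  assert (Hr : forall j, 0 < r j) by (intros; apply Hv).
  assert (Hchain : forall k i, (I k <= I (i + k))%nat /\ agree (A k) (u k) (u (i + k)%nat) /\ incl (A k) (A (i + k)%nat) /\
    forall n, (n <= I k)%nat -> p n (fsub (u (i + k)%nat) (u k)) <= (r k - r (i + k)%nat) / 2).
  { intros k i. induction i as [|i [IH1 [IH2 [IH3 IH4]]]].
    - split; [simpl; lia|]. split; [apply agree_refl|]. split; [apply incl_refl|].
      intros n _. simpl. rewrite p_sub_diag by auto. lra.
    - destruct (Hs (i + k)%nat) as [_ [S1 [S2 [S3 [S4 [S5 [S6 _]]]]]]].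
      fold (u (i + k)%nat) in *. fold (u (S (i + k))) in *. fold (r (i + k)%nat) in *. fold (r (S (i + k))) in *.
      change (S i + k)%nat with (S (i + k)).
      assert (S4' : (I (i + k) <= I (S (i + k)))%nat) by exact S4.
      split; [lia|]. split; [eapply agree_trans; eauto|]. split; [eapply incl_tran; eauto|].
      intros n Hn. specialize (IH4 n Hn). specialize (S1 n ltac:(unfold I in *; lia)).
      pose proof (p_sub_triangle n (u (S (i + k))) (u (i + k)%nat) (u k) (HFu _) (HFu _) (HFu _)). lra. }
  assert (Hr0 : forall j, r j <= r O * (/ 2) ^ j).
  { induction j as [|j IH]; [simpl; lra|].
    destruct (Hs j) as [_ [_ [_ [_ [_ [_ [S6 _]]]]]]]. fold (r j) in S6. fold (r (S j)) in S6. simpl pow. lra. }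
  assert (HI : forall j, (j <= I (S j))%nat) by (intros j; apply (Hs j)).
  assert (Hle : forall k j, (k <= j)%nat -> exists i, j = (i + k)%nat) by (intros k j h; exists (j - k)%nat; lia).
  destruct (fr_complete _ _ HF u HFu) as [g [Hg Hconv]].
  { intros n e Hep.
    destruct (pow_lt_1_zero (/ 2) ltac:(rewrite Rabs_pos_eq; lra) (e / r O)) as [M HM].
    { apply Rdiv_lt_0_compat; auto. }
    set (K := S (max n M)).
    assert (HrK : r K < e).
    { eapply Rle_lt_trans; [apply Hr0|]. specialize (HM K ltac:(unfold K; lia)).
      rewrite Rabs_pos_eq in HM by (apply pow_le; lra). pose proof (Hr O).
      apply Rlt_le_trans with (r O * (e / r O)); [now apply Rmult_lt_compat_l|right; field; lra]. }
    assert (HnK : (n <= I K)%nat) by (pose proof (HI (max n M)); unfold K; lia).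
    exists K. intros k l Hk Hl. destruct (Hle _ _ Hk) as [i ->]. destruct (Hle _ _ Hl) as [i' ->].
    destruct (Hchain K i) as [_ [_ [_ B1]]]. destruct (Hchain K i') as [_ [_ [_ B2]]].
    specialize (B1 n HnK). specialize (B2 n HnK).
    pose proof (p_sub_triangle n (u (i + K)%nat) (u K) (u (i' + K)%nat) (HFu _) (HFu _) (HFu _)) as T.
    rewrite (p_sub_sym n (u K)) in T by auto. pose proof (Hr (i + K)%nat). pose proof (Hr (i' + K)%nat).
    lra. }
  assert (Hnear : forall k, near p (I k) (r k) (u k) g).
  (* The distance from [u k] to [u (K + k)] is below [r k / 2], and from there to [g] below
     [r k / 4]. *)
  { intros k n Hn. destruct (Hconv n (r k / 4)) as [K HK]; [pose proof (Hr k); lra|].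
    specialize (HK (K + k)%nat ltac:(lia)). destruct (Hchain k K) as [_ [_ [_ B]]]. specialize (B n Hn).
    pose proof (p_sub_triangle n g (u (K + k)%nat) (u k) Hg (HFu _) (HFu _)) as T.
    rewrite (p_sub_sym n g (u (K + k)%nat)) in T by auto. pose proof (Hr (K + k)%nat). pose proof (Hr k). lra. }
  exists g. split; auto. split; [exact (Hnear O)|].
  intros j. destruct (Hs j) as [_ [_ [_ [_ [_ [_ [_ H]]]]]]]. apply H; auto; [|exact (Hnear (S j))].
  apply (agree_limit u g (A (S j)) (u (S j)) (S j)); auto.
  intros k Hk. destruct (Hle _ _ Hk) as [i ->]. apply Hchain.
Qed.

End FrechetTopology.

Theorem theorem1p4 (F : (C -> C) -> Prop) (p : nat -> (C -> C) -> R)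
  (E Lam : C -> Prop) :
  FrechetEntire F p ->
  (forall f, is_poly_map f -> F f) ->
  finer_than_local_uniform F p ->
  countable_set E -> dense_set E ->
  dense_set Lam ->
  forall f, F f -> forall (N : nat) (eps : R), 0 < eps ->
    exists g, F g /\ (forall n, (n <= N)%nat -> p n (fsub g f) < eps) /\
      good_map E Lam g.
Proof.
  intros HF Hpoly Hfine [e Henum] HE HLam f Hf N eps Heps.
  (* [j] codes a pair: [i] selects both a point of the enumeration and the period [S i], which is
     never 0; the other entry is the radius of a disc about 0. *)
  pose (P := fun j (k : C -> C) => let i := fst (Cantor.of_nat j) in let r := INR (snd (Cantor.of_nat j)) in
    (E (e i) -> E (k (e i)) /\ forall z, Cmod z <= r -> k z = e i -> E z) /\
    (forall z, Cmod z <= r -> iterate k (S i) z = z ->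
       E z /\ forall lam, multiplier_at k z (S i) lam -> Lam lam)).
  destruct (generic_map F p HF Hfine E Lam P f N eps) as [g [Hg [Hnear HP]]]; auto.
  { intros j. pose proof (pos_INR (snd (Cantor.of_nat j))) as Hr.
    apply lockable_and; auto.
    - apply lockable_impl; auto. intros Hei. apply lockable_and; auto.
      + now apply lockable_value.
      + now apply lockable_preimages.
    - apply lockable_cycles; auto. lia. }
  assert (HP' : forall i z, exists j, fst (Cantor.of_nat j) = i /\ Cmod z <= INR (snd (Cantor.of_nat j))).
  { intros i z. destruct (INR_unbounded (Cmod z)) as [r Hr]. exists (Cantor.to_nat (i, r)).
    rewrite Cantor.cancel_of_to. simpl. split; [auto|lra]. }
  assert (Hcyc : forall z n, (1 <= n)%nat -> iterate g n z = z ->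
    E z /\ forall lam, multiplier_at g z n lam -> Lam lam).
  { intros z n Hn Hz.
    destruct (HP' (n - 1)%nat z) as [j [Hi Hr]]. destruct (HP j) as [_ Q]. rewrite Hi in Q.
    replace (S (n - 1)) with n in Q by lia. auto. }
  exists g. split; auto. split; auto. split; [|split].
  (* [E (g z) -> E z] uses the enumeration index of [g z] and a disc containing [z]; the converse
     uses the index of [z]. *)
  - intros z. split; intros Hz.
    + destruct (Henum _ Hz) as [i Hi]. destruct (HP' i z) as [j [Hj Hr]].
      destruct (HP j) as [Q _]. rewrite Hj, Hi in Q. destruct (Q Hz) as [_ Q2]. auto.
    + destruct (Henum _ Hz) as [i Hi]. destruct (HP' i z) as [j [Hj _]].
      destruct (HP j) as [Q _]. rewrite Hj, Hi in Q. destruct (Q Hz) as [Q1 _]. exact Q1.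
  - intros z [n [Hn Hz]]. now apply (Hcyc z n).
  - intros z n lam Hm. pose proof Hm as [[H1 [H2 _]] _]. now apply (Hcyc z n).
Qed.
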